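(* Let $X$ be an infinite zero-dimensional compact metric space. Let $K$ be the commutative subgroup of $H(X)$ generated by $\{\psi_1,\dots,\psi_d\}$. Let $\alpha:\mathbb Z^d\to K$ be the $\mathbb Z^d$-action defined by $\alpha^{(m_1,\dots,m_d)}=\psi_1^{m_1}\cdots\psi_d^{m_d}$. Let $\mathbf k=(k_1,\dots,k_d)$ be an expansive integral vector for $\alpha$ and $\mathbf m=(m_1,\dots,m_d)$ an integral vector. Then $\mathbf m$ belongs to the connected component of $\mathcal E_R(\alpha,\mathbf k)$ containing $\mathbf k$ if and only if $\alpha^{\mathbf m}\in PL_K^\circ(\alpha^{\mathbf k})$, i.e. $\alpha^{\mathbf m}$ is a right $\alpha^{\mathbf k}$-expansive, essentially weakly $p$-L automorphism of $(X,\alpha^{\mathbf k})$. Likewise, $\mathbf m$ belongs to the connected component of $\mathcal E_L(\alpha,\mathbf k)$ containing $\mathbf k$ if and only if $\alpha^{\mathbf m}\in QR_K^\circ(\alpha^{\mathbf k})$, i.e. $\alpha^{\mathbf m}$ is a left $\alpha^{\mathbf k}$-expansive, essentially weakly $q$-R automorphism of $(X,\alpha^{\mathbf k})$.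
   Context: **Basics.** $H(X)$ is the group of homeomorphisms of $X$; $d_X$ is the metric. A homeomorphism $\tau$ of $X$ is expansive if there is $\delta>0$ such that $d_X(\tau^j(x),\tau^j(y))\le\delta$ for all $j\in\mathbb Z$ implies $x=y$. An automorphism of $(X,\tau)$ is a homeomorphism of $X$ commuting with $\tau$. For commuting homeomorphisms $\psi,\tau$, $\psi$ is left (resp. right) $\tau$-expansive if there is $\delta>0$ such that $d_X(\tau^j\psi^i(x),\tau^j\psi^i(y))\le\delta$ for all $i\in\mathbb Z$ and all $j\le0$ (resp. $j\ge0$) implies $x=y$. A subshift $(X',\sigma')$ over a finite alphabet $A$ is a closed $X'\subset A^{\mathbb Z}$ with $\sigma'(X')=X'$, $\sigma'$ being the shift $(a_j)\mapsto(a_{j+1})$. **Resolving automorphisms.** A graph is a finite directed graph $G$ (multiple arcs, loops allowed) with arc-set $A_G$, vertex-set $V_G$ and initial/terminal vertex maps $i_G,t_G$; $X_G\subset A_G^{\mathbb Z}$ is the set of bi-infinite paths. A graph-homomorphism $h=(h_A,h_V):\Gamma\to G$ is a pair of maps on arcs and vertices compatible with $i,t$; it induces $\phi_h:X_\Gamma\to X_G$, $(\alpha_j)\mapsto(h_A(\alpha_j))$. $h$ is weakly left-resolving (resp. weakly right-resolving) if every arc $\gamma$ of $\Gamma$ is uniquely determined by $t_\Gamma(\gamma)$ (resp. $i_\Gamma(\gamma)$) and $h_A(\gamma)$. A textile system is a pair $(p,q:\Gamma\to G)$ of graph-homomorphisms; it is weakly $p$-L if $p$ is weakly left-resolving, weakly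 $q$-R if $q$ is weakly right-resolving. For $\mathcal P\in\{p\text{-L},q\text{-R}\}$, a continuous shift-commuting map $\varphi':X'\to X'$ of a subshift is weakly $\mathcal P$ if there are a weakly $\mathcal P$ textile system $(p,q:\Gamma\to G)$ and a closed shift-invariant $Z\subset X_\Gamma$ such that $\phi_p|_Z$ is injective, $\phi_p(Z)=X'$, $\phi_q(Z)\subset X'$ and $\varphi'=\phi_q\circ(\phi_p|_Z)^{-1}$. An automorphism $\psi$ of $(X,\tau)$ is essentially weakly $\mathcal P$ if there are a subshift $(X',\sigma')$, a weakly $\mathcal P$ endomorphism $\varphi'$ of it and a homeomorphism $\theta:X\to X'$ with $\theta\tau=\sigma'\theta$, $\theta\psi=\varphi'\theta$. For expansive $\tau\in K$, $PL_K^\circ(\tau)$ (resp. $QR_K^\circ(\tau)$) is the set of $\psi\in K$ that are essentially weakly $p$-L and right $\tau$-expansive (resp. essentially weakly $q$-R and left $\tau$-expansive) automorphisms of $(X,\tau)$. **Expansive subsets of $\mathbb R^d$.** For $F\subset\mathbb R^d$ and $t\ge0$, $F^t$ is the set of points at Euclidean distance at most $t$ from $F$. $F$ is expansive for $\alpha$ if there are $\delta>0$, $t\ge0$ such that for $x,y\in X$, $d_X(\alpha^{\mathbf n}(x),\alpha^{\mathbf n}(y))\le\delta$ for all $\mathbf n\in F^t\cap\mathbb Z^d$ implies $x=y$. An integral vector $\mathbf k$ is expansive for $\alpha$ if $\alpha^{\mathbf k}$ is expansive. For a subspace $V\subset\mathbb R^d$ put $(V,\mathbf k)_+=\{\mathbf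 v+b\mathbf k:\mathbf v\in V,b\ge0\}$ and $(V,\mathbf k)_-=\{\mathbf v+b\mathbf k:\mathbf v\in V,b\le0\}$; $V$ is right (resp. left) $\mathbf k$-expansive for $\alpha$ if $(V,\mathbf k)_+$ (resp. $(V,\mathbf k)_-$) is expansive for $\alpha$. $\mathcal E_R(\alpha,\mathbf k)$ (resp. $\mathcal E_L(\alpha,\mathbf k)$) is the union of all right (resp. left) $\mathbf k$-expansive one-dimensional subspaces of $\mathbb R^d$, with $\mathbf 0$ removed. *)

(* Defs.v *)
From HB Require Import structures.
From mathcomp Require Import all_boot all_order all_algebra.
From mathcomp Require Import all_classical all_reals all_analysis.

Set Implicit Arguments.
Unset Strict Implicit.
Unset Printing Implicit Defensive.

Import Order.TTheory GRing.Theory Num.Theory.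
Import numFieldNormedType.Exports.

Local Open Scope classical_set_scope.
Local Open Scope ring_scope.

Section HomeoGroup.
Variable X : topologicalType.

Record homeo := Homeo {
  homeo_fun :> X -> X;
  homeo_inv : X -> X;
  homeo_funK : cancel homeo_fun homeo_inv;
  homeo_invK : cancel homeo_inv homeo_fun;
  homeo_fun_continuous : continuous homeo_fun;
  homeo_inv_continuous : continuous homeo_inv }.

HB.instance Definition _ := gen_eqMixin homeo.
HB.instance Definition _ := gen_choiceMixin homeo.

Lemma homeo_eq (f g : homeo) : f =1 g -> f = g.
Proof.
move=> fg; have /= /funext efg := fg.
case: f g efg {fg} => [f f' fK f'K cf cf'] [g g' gK g'K cg cg'] /= efg.
subst g; have efg' : f' = g' by apply/funext => x; rewrite -{1}(g'K x) fK.
by subst g'; congr Homeo; apply: Prop_irrelevance.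
Qed.

Definition homeo_one : homeo := @Homeo id id (fun=> erefl) (fun=> erefl)
  (fun x => @cvg_id _ (nbhs x)) (fun x => @cvg_id _ (nbhs x)).

Definition homeo_mul (f g : homeo) : homeo := @Homeo
  (f \o g) (homeo_inv g \o homeo_inv f)
  (can_comp (homeo_funK f) (homeo_funK g))
  (can_comp (homeo_invK g) (homeo_invK f))
  (fun x => continuous_comp (@homeo_fun_continuous g x)
                            (@homeo_fun_continuous f (g x)))
  (fun x => continuous_comp (@homeo_inv_continuous f x)
                            (@homeo_inv_continuous g (homeo_inv f x))).

Definition homeo_invg (f : homeo) : homeo :=
  @Homeo (homeo_inv f) f (homeo_invK f) (homeo_funK f)
    (@homeo_inv_continuous f) (@homeo_fun_continuous f).

Lemma homeo_mulA : associative homeo_mul.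
Proof. by move=> f g h; apply: homeo_eq. Qed.

Lemma homeo_mul1 : left_id homeo_one homeo_mul.
Proof. by move=> f; apply: homeo_eq. Qed.

Lemma homeo_mulr1 : right_id homeo_one homeo_mul.
Proof. by move=> f; apply: homeo_eq. Qed.

Lemma homeo_mulV : left_inverse homeo_one homeo_invg homeo_mul.
Proof. by move=> f; apply: homeo_eq => x /=; exact: homeo_funK. Qed.

Lemma homeo_mulrV : right_inverse homeo_one homeo_invg homeo_mul.
Proof. by move=> f; apply: homeo_eq => x /=; exact: homeo_invK. Qed.

HB.instance Definition _ := isGroup.Build homeo
  homeo_mulA homeo_mul1 homeo_mulr1 homeo_mulV homeo_mulrV.

End HomeoGroup.

Section Groups.
Variable G : groupType.
Local Open Scope group_scope.

Definition zexpg (g : G) (n : int) : G :=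
  match n with Posz m => g ^+ m | Negz m => g ^- m.+1 end.

Definition subgroup_generated (S : set G) : set G :=
  smallest [set M : set G | group_closed (mem M)] S.

Definition zd_action (d : nat) (psi : 'I_d -> G) (m : 'rV[int]_d) : G :=
  \prod_(i < d) zexpg (psi i) (m ord0 i).

End Groups.

Section Expansive.
Variables (R : realType) (X : metricType R).

Definition expansive (tau : homeo X) : Prop :=
  exists2 delta : R, 0 < delta &
    forall x y : X,
      (forall j : int, mdist (zexpg tau j x) (zexpg tau j y) <= delta) ->
      x = y.

Definition left_expansive (tau psi : homeo X) : Prop :=
  exists2 delta : R, 0 < delta &
    forall x y : X,
      (forall i j : int, j <= 0 ->
        mdist (zexpg tau j (zexpg psi i x)) (zexpg tau j (zexpg psi i y))
          <= delta) ->
      x = y.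

Definition right_expansive (tau psi : homeo X) : Prop :=
  exists2 delta : R, 0 < delta &
    forall x y : X,
      (forall i j : int, 0 <= j ->
        mdist (zexpg tau j (zexpg psi i x)) (zexpg tau j (zexpg psi i y))
          <= delta) ->
      x = y.

End Expansive.

Section Subshifts.

Definition fullshift (A : finType) : Type := {ptws int -> discrete_topology A}.

HB.instance Definition _ (A : finType) :=
  Topological.copy (fullshift A) {ptws int -> discrete_topology A}.

Definition shift_map (A : finType) (a : fullshift A) : fullshift A :=
  fun j : int => a (j + 1).

Definition is_subshift (A : finType) (Y : set (fullshift A)) : Prop :=
  closed Y /\ @shift_map A @` Y = Y.

(* An endomorphism of Y is represented by a map of the ambient full shift, of
   which only the restriction to Y matters. *)
Definition subshift_endomorphism (A : finType) (Y : set (fullshift A))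
    (phi : fullshift A -> fullshift A) : Prop :=
  [/\ {within Y, continuous phi},
      set_fun Y Y phi &
      forall a, Y a -> phi (shift_map a) = shift_map (phi a)].

End Subshifts.

(* The arc-set is a parameter rather than a field, so that a subshift over the
   alphabet A can be compared with the paths of a graph having A as arc-set. *)
Record graph (A : finType) := Graph {
  vertex : finType;
  init : A -> vertex;
  term : A -> vertex }.

Definition graph_shift (A : finType) (G : graph A) : set (fullshift A) :=
  [set a | forall j : int, term G (a j) = init G (a (j + 1))].

Record graph_hom (B A : finType) (Gamma : graph B) (G : graph A) := GraphHom {
  hom_arc : B -> A;
  hom_vertex : vertex Gamma -> vertex G;
  hom_init : forall b, init G (hom_arc b) = hom_vertex (init Gamma b);
  hom_term : forall b, term G (hom_arc b) = hom_vertex (term Gamma b) }.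

Section GraphHom.
Variables (B A : finType) (Gamma : graph B) (G : graph A).
Implicit Type h : graph_hom Gamma G.

(* phi_h, extended to all of B^Z by the same formula *)
Definition hom_map h (b : fullshift B) : fullshift A :=
  fun j : int => hom_arc h (b j).

Definition weakly_left_resolving h : Prop :=
  injective (fun b : B => (term Gamma b, hom_arc h b)).

Definition weakly_right_resolving h : Prop :=
  injective (fun b : B => (init Gamma b, hom_arc h b)).

End GraphHom.

Record textile (B A : finType) (Gamma : graph B) (G : graph A) := Textile {
  textile_p : graph_hom Gamma G;
  textile_q : graph_hom Gamma G }.

Variant resolving_type := pL | qR.

Definition weakly_resolving (P : resolving_type) (B A : finType)
    (Gamma : graph B) (G : graph A) (T : textile Gamma G) : Prop :=
  match P with
  | pL => weakly_left_resolving (textile_p T)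
  | qR => weakly_right_resolving (textile_q T)
  end.

(* The last clause says phi = phi_q \o (phi_p|_Z)^-1 on Y = phi_p(Z). *)
Definition weakly_endomorphism (P : resolving_type) (A : finType)
    (Y : set (fullshift A)) (phi : fullshift A -> fullshift A) : Prop :=
  subshift_endomorphism Y phi /\
  exists (G : graph A) (B : finType) (Gamma : graph B) (T : textile Gamma G)
         (Z : set (fullshift B)),
    [/\ weakly_resolving P T,
        is_subshift Z /\ Z `<=` graph_shift Gamma,
        set_inj Z (hom_map (textile_p T)) /\
          hom_map (textile_p T) @` Z = Y,
        hom_map (textile_q T) @` Z `<=` Y &
        forall z, Z z ->
          phi (hom_map (textile_p T) z) = hom_map (textile_q T) z].

Section Essentially.
Variable X : topologicalType.

Definition automorphism (tau psi : homeo X) : Prop := commute psi tau.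

Definition homeo_onto (A : finType) (Y : set (fullshift A))
    (theta : X -> fullshift A) : Prop :=
  [/\ continuous theta, set_bij setT Y theta &
      exists theta' : fullshift A -> X,
        {within Y, continuous theta'} /\ cancel theta theta'].

Definition essentially_weakly (P : resolving_type) (tau psi : homeo X) : Prop :=
  exists (A : finType) (Y : set (fullshift A))
         (phi : fullshift A -> fullshift A) (theta : X -> fullshift A),
    [/\ is_subshift Y,
        weakly_endomorphism P Y phi,
        homeo_onto Y theta,
        forall x, theta (tau x) = shift_map (theta x) &
        forall x, theta (psi x) = phi (theta x)].

End Essentially.

Section PLQR.
Variables (R : realType) (X : metricType R).

Definition PLo (K : set (homeo X)) (tau : homeo X) : set (homeo X) :=
  [set psi | [/\ K psi, automorphism tau psi, essentially_weakly pL tau psi &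
                 right_expansive tau psi]].

Definition QRo (K : set (homeo X)) (tau : homeo X) : set (homeo X) :=
  [set psi | [/\ K psi, automorphism tau psi, essentially_weakly qR tau psi &
                 left_expansive tau psi]].

End PLQR.

Section ExpansiveSubsets.
Variables (R : realType) (X : metricType R) (d : nat).
Variable alpha : 'rV[int]_d -> homeo X.

Definition intvec (n : 'rV[int]_d) : 'rV[R]_d := map_mx intr n.

(* The library norm on matrices is the sup norm, hence this definition. *)
Definition euclidean_dist (u v : 'rV[R]_d) : R :=
  Num.sqrt (\sum_(i < d) (u ord0 i - v ord0 i) ^+ 2).

Definition thickening (F : set 'rV[R]_d) (t : R) : set 'rV[R]_d :=
  [set v | (ereal_inf [set (euclidean_dist v w)%:E | w in F] <= t%:E)%E].

Definition expansive_set (F : set 'rV[R]_d) : Prop :=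
  exists delta t : R,
    [/\ 0 < delta, 0 <= t &
        forall x y : X,
          (forall n : 'rV[int]_d, thickening F t (intvec n) ->
             mdist (alpha n x) (alpha n y) <= delta) ->
          x = y].

Definition expansive_vector (k : 'rV[int]_d) : Prop := expansive (alpha k).

Definition half_plus (V : {vspace 'rV[R]_d}) (k : 'rV[int]_d) :
    set 'rV[R]_d :=
  [set w | exists v b, [/\ v \in V, 0 <= b & w = v + b *: intvec k]].

Definition half_minus (V : {vspace 'rV[R]_d}) (k : 'rV[int]_d) :
    set 'rV[R]_d :=
  [set w | exists v b, [/\ v \in V, b <= 0 & w = v + b *: intvec k]].

Definition right_expansive_space (k : 'rV[int]_d) (V : {vspace 'rV[R]_d}) :
  Prop := expansive_set (half_plus V k).

Definition left_expansive_space (k : 'rV[int]_d) (V : {vspace 'rV[R]_d}) :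
  Prop := expansive_set (half_minus V k).

Definition ER (k : 'rV[int]_d) : set 'rV[R]_d :=
  [set w | w != 0 /\ exists V : {vspace 'rV[R]_d},
    [/\ \dim V = 1%N, right_expansive_space k V & w \in V]].

Definition EL (k : 'rV[int]_d) : set 'rV[R]_d :=
  [set w | w != 0 /\ exists V : {vspace 'rV[R]_d},
    [/\ \dim V = 1%N, left_expansive_space k V & w \in V]].

End ExpansiveSubsets.

(* Main.v *)
Require Import Defs.
From HB Require Import structures.
From mathcomp Require Import all_boot all_order all_algebra.
From mathcomp Require Import all_classical all_reals all_analysis.
From mathcomp Require Import zify ring lra.
Import Order.TTheory GRing.Theory Num.Theory.
Import numFieldNormedType.Exports.
Local Open Scope classical_set_scope.
Local Open Scope ring_scope.
Set Implicit Arguments.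
Unset Strict Implicit.
Unset Printing Implicit Defensive.

(** Choose a finite clopen partition of [X] so fine that the labels of the
    points [alpha (j k) x], [j] an integer, determine [x].  Every question then
    becomes one about sets of integer vectors: for two points [x] and [y],
    which sets of vectors are such that agreement of the labels there forces
    agreement elsewhere?  A real vector [w] is determining if labels along the
    half-plane [{a w + b k | 0 <= b}], suitably thickened, determine the point.
    The determining vectors are exactly the elements of [ER alpha k]
    ([ER_determining]); the vector 0 is not among them because otherwise
    [alpha k] would be positively expansive and [X] finite
    ([not_determining0]).

    By compactness a determining half-plane does its work locally: a large
    bounded piece of it determines the labels on a ball around the origin.
    Hence being determining is an open condition, uniform on compact sets, and
    a frontier between known and unknown labels can be moved forward wherever
    it is nearly flat and its tangents are determining.  This is applied to two
    frontiers.

    - Hyperbolas ([hyperbola_determining]).  If vectors arbitrarily close to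
      [w] are joined to [k] by a segment of determining vectors, then so is
      [w], as soon as [w] itself is determining ([determining_limit]): labels
      on a half-plane in the plane of [k] and [w] spread, at bounded speed, to
      a wedge in the plane of [k] and a nearby vector, and the hyperbola
      inscribed in the wedge can be moved until it has swept the whole plane.
      So the set [star] of vectors seen from [k] is open and closed among the
      determining vectors, and it is the component of [k] ([component_star]).

    - Circles ([disc_determines]).  If the whole segment from [k] to [m] is
      determining, then the labels on a large disc [D] and on [D + m + k]
      determine those on [D + m], because the tangents at the points of [D + m]
      outside both other discs point between [k] and [m].  With [c x] the
      labels of [x] on [D], [tau = alpha k] and [psi = alpha m], this says that
      [c (psi x)] is a function of [c x] and [c (psi (tau x))].  These triples
      are the squares of a textile system which is weakly [p]-L
      ([pL_of_label]).

    Conversely, in a weakly [p]-L textile system the bottom and right edges of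
    a rectangle determine all its squares, and half-planes between those of [k]
    and [m] contain such edges for rectangles covering the plane
    ([pL_determining]); the end point [m] of the segment is determining
    precisely when [alpha m] is right expansive
    ([right_expansive_determining]).  This proves the equivalence for [ER]
    ([component_pL]).  The equivalence for [EL] follows by replacing [k] and
    [m] by their opposites, since a textile system turned by half a turn
    presents the inverses and is resolving on the other side
    ([essentially_weakly_dual]). *)

(** * Locally constant maps on compact spaces *)

Definition locally_constant (X : topologicalType) (T : Type) (L : X -> T) :=
  forall x, \forall y \near x, L y = L x.

Section LocallyConstant.
Variable X : topologicalType.

Lemma locally_constant_comp (T U : Type) (g : T -> U) (L : X -> T) :
  locally_constant L -> locally_constant (g \o L).
Proof. by move=> lcL x; apply: filterS (lcL x) => y /= ->. Qed.

Lemma locally_constant_precomp (Y : topologicalType) (T : Type) (L : X -> T)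
    (f : Y -> X) :
  continuous f -> locally_constant L -> locally_constant (L \o f).
Proof. by move=> cf lcL x; exact: (cf x _ (lcL (f x))). Qed.

Lemma locally_constant_ffun (I : finType) (T : Type) (L : I -> X -> T) :
  (forall i, locally_constant (L i)) ->
  locally_constant (fun x => [ffun i => L i x]).
Proof.
move=> lcL x.
have : \forall y \near x, forall i, i \in enum I -> L i y = L i x.
  elim: (enum I) => [|i s IHs]; first by near=> y.
  near=> y => j; rewrite inE => /predU1P[->|js].
    by near: y; exact: lcL.
  by move: j js; near: y.
by apply: filterS => y Ly; apply/ffunP => i; rewrite !ffunE Ly// mem_enum.
Unshelve. all: by end_near. Qed.

Lemma disagreement_near (I : Type) (T : Type) (f : I -> X -> T)
    (D : I -> Prop) (x y : X) :
  (forall i, locally_constant (f i)) ->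
  ~ (forall i, D i -> f i x = f i y) ->
  \forall z \near (x, y), ~ (forall i, D i -> f i z.1 = f i z.2).
Proof.
move=> lcf /existsNP[i /not_implyP[Di fixy]].
exists ([set x' | f i x' = f i x], [set y' | f i y' = f i y]).
  by split; exact: lcf.
by move=> [x' y'] /= [fx fy] /(_ i Di); rewrite fx fy.
Qed.

(** Compactness of the square of [X]: near a diagonal point [L] takes the same
    value on both coordinates, and near any other pair some observation [f i],
    hence some stage [D n], keeps telling them apart. *)
Lemma finite_determination (I T U : Type) (f : I -> X -> T)
    (D : nat -> I -> Prop) (L : X -> U) :
  compact [set: X] ->
  (forall i, locally_constant (f i)) ->
  (forall m n i, (m <= n)%N -> D m i -> D n i) ->
  (forall x y, (forall n i, D n i -> f i x = f i y) -> x = y) ->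
  locally_constant L ->
  exists N, forall x y, (forall i, D N i -> f i x = f i y) -> L x = L y.
Proof.
move=> cX lcf monoD sepf lcL.
have cXX : compact [set: X * X] by rewrite -setXTT; exact: compact_setX.
pose P n (z : X * X) := (forall i, D n i -> f i z.1 = f i z.2) -> L z.1 = L z.2.
have [] := (compact_near_coveringP _).1 cXX nat \oo P.
  move=> [x y] _; have [/(sepf x y) eqxy|] :=
    pselect (forall n i, D n i -> f i x = f i y).
    rewrite eqxy.
    exists ([set z | L z.1 = L y /\ L z.2 = L y], setT) => /=.
      split; last exact: filterT.
      by exists ([set x' | L x' = L y], [set x' | L x' = L y]) => //; split; exact: lcL.
    by move=> [[x' y'] n] /= [[Lx Ly] _]; rewrite /P /= Lx Ly.
  move=> /existsNP[n nDn].
  exists ([set z | ~ forall i, D n i -> f i z.1 = f i z.2], [set p | (n <= p)%N]).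
    by split; [exact: disagreement_near|exists n].
  move=> [[x' y'] p] /= [nagree np] agreep; exfalso; apply: nagree => i Di.
  by apply: agreep; exact: monoD Di.
by move=> N _ PN; exists N => x y; exact: (PN N (leqnn N) (x, y) Logic.I).
Qed.

End LocallyConstant.

Section CompactMetric.
Variables (R : realType) (X : metricType R).
Hypothesis X_compact : compact [set: X].

Let mdist_triangle (y x z : X) : mdist x z <= mdist x y + mdist y z.
Proof. exact: metric_triangle. Qed.

(** A Lebesgue number of the partition into level sets. *)
Lemma locally_constant_uniform (T : Type) (L : X -> T) : locally_constant L ->
  exists2 delta : R, 0 < delta & forall x y, mdist x y <= delta -> L x = L y.
Proof.
move=> lcL.
pose P n (x : X) := forall y, mdist x y <= n.+1%:R^-1 :> R -> L x = L y.
have [] := (compact_near_coveringP _).1 X_compact nat \oo P.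
  move=> x _.
  have /nbhs_ballP[e /= e0 eL] := lcL x.
  have e20 : 0 < e / 2 by rewrite divr_gt0.
  exists (ball x (e / 2), [set n | n.+1%:R^-1 < e / 2]).
    by split; [exact: nbhsx_ballx|exact: near_infty_natSinv_lt (PosNum e20)].
  move=> [x' n] /=; rewrite ballEmdist => -[/= xx' ne] y x'y.
  rewrite [L x'](_ : _ = L x); last first.
    by apply: eL; rewrite ballEmdist /=; lra.
  apply/esym/eL; rewrite ballEmdist /=.
  have := mdist_triangle x' x y; have := le_lt_trans x'y ne; lra.
move=> N _ PN; exists N.+1%:R^-1; first by rewrite invr_gt0.
by move=> x y; exact: (PN N (leqnn N) x Logic.I y).
Qed.

(** The label of a point records which members of a finite cover by small
    clopen sets contain it. *)
Lemma clopen_labelling (delta : R) : zero_dimensional X -> 0 < delta ->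
  exists (A : finType) (P : X -> A), locally_constant P /\
    forall x y, P x = P y -> mdist x y <= delta.
Proof.
move=> X0 delta0.
have cvgX x := @zero_dimensional_cvg X x (@metric_hausdorff _ _) X0 X_compact.
have /choice[U UP] (x : X) : exists U, [/\ clopen U, U x & U `<=` ball x (delta / 2)].
  have [|D [Dx cD] Dball] := cvgX x (ball x (delta / 2)).
    by apply: nbhsx_ballx; rewrite divr_gt0.
  by exists D.
pose good (F : seq X) (x : X) := exists2 y, y \in F & U y x.
have [F cF] : exists F : seq X, forall x, good F x.
  have := (compact_near_coveringP _).1 X_compact _
     (filter_from setT (fun F : seq X => [set G : seq X | {subset F <= G}])) good.
  case.
  - apply: filter_from_filter; first by exists [::].
    move=> F G _ _; exists (F ++ G) => // H /= FGH.
    by split=> z zF; apply: FGH; rewrite mem_cat zF ?orbT.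
  - move=> x _; have [[oU _] Ux _] := UP x.
    exists (U x, [set G : seq X | x \in G]).
      split; first by apply: open_nbhs_nbhs.
      by exists [:: x] => // G /= ->//; rewrite inE.
    by move=> [x' G] /= [Ux' xG]; exists x.
  by move=> F _ FP; exists F => x; exact: FP.
pose P (x : X) := [ffun i : 'I_(size F) => `[< U (tnth (in_tuple F) i) x >]].
exists {ffun 'I_(size F) -> bool}, P; split.
  apply: locally_constant_ffun => i x; have [[oU cU] _ _] := UP (tnth (in_tuple F) i).
  have [Ux|nUx] := pselect (U (tnth (in_tuple F) i) x).
    have := open_nbhs_nbhs (conj oU Ux); apply: filterS => y Uy.
    by apply/asbool_equiv_eq.
  have := open_nbhs_nbhs (conj (closed_openC cU) nUx); apply: filterS => y nUy.
  by apply/asbool_equiv_eq; split.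
move=> x y /ffunP Pxy; have [z zF Uzx] := cF x.
have := Pxy (Ordinal (etrans (index_mem z F) zF)); rewrite !ffunE (tnth_nth x) /= nth_index//.
move=> Uzxy; have Uzy : U z y by apply/asboolP; rewrite -Uzxy; exact/asboolP.
have [_ _ sub] := UP z; have := sub _ Uzx; have := sub _ Uzy.
rewrite !ballEmdist /= => zy zx.
by have := mdist_triangle z x y; rewrite (metric_sym x z); lra.
Qed.

End CompactMetric.

Section FullShift.

Lemma fullshift_hausdorff (A : finType) : hausdorff_space (fullshift A).
Proof. by apply: hausdorff_product => j; exact: discrete_hausdorff. Qed.

Lemma coordinate_locally_constant (A : finType) (j : int) :
  locally_constant (fun a : fullshift A => a j).
Proof.
move=> a.
exact: (@proj_continuous int (fun=> discrete_topology A) j a _ (discrete_set1 (a j))).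
Qed.

Lemma continuous_coordinates (X : topologicalType) (A : finType)
    (f : X -> fullshift A) :
  (forall j, locally_constant (fun x => f x j)) -> continuous f.
Proof.
move=> lcf x; apply/cvg_sup => j; apply/cvg_image.
  by apply/seteqP; split=> // a _; exists (fun=> a).
move=> B /nbhs_singleton Bfx.
have := lcf j x; rewrite -nbhs_nearE => lcfx.
exists [set g : fullshift A | B (g j)].
  by apply: filterS lcfx => y /= ->.
apply/seteqP; split=> [_ [g Bg <-]//|a Ba].
by exists (fun=> a).
Qed.

Lemma hom_map_continuous (B A : finType) (Gamma : graph B) (G : graph A)
  (h : graph_hom Gamma G) : continuous (hom_map h).
Proof.
apply: continuous_coordinates => j.
exact/(locally_constant_comp (hom_arc h))/coordinate_locally_constant.
Qed.

Lemma fullshift_compact (A : finType) : compact [set: fullshift A].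
Proof.
have := @tychonoff int (fun=> discrete_topology A) (fun=> setT).
set K := [set f | _]; suff -> : K = setT.
  by apply=> j; apply: finite_compact; exact: (@finite_finset A setT).
by apply/seteqP; split.
Qed.

End FullShift.

Lemma continuous_image_closed (X Y : topologicalType) (K : set X) (f : X -> Y) :
  hausdorff_space Y -> compact K -> continuous f -> closed (f @` K).
Proof.
move=> hY cK cf; apply: (compact_closed hY); apply: continuous_compact cK.
exact: continuous_subspaceT.
Qed.

(** The closed subsets of [K] are compact, so their images, which are their
    preimages under [g], are closed. *)
Lemma compact_inverse_continuous (X Y : topologicalType) (K : set X)
    (f : X -> Y) (g : Y -> X) :
  hausdorff_space Y -> compact K -> continuous f ->
  (forall x, K x -> g (f x) = x) -> {within f @` K, continuous g}.
Proof.
move=> hY cK cf fK; apply/continuous_closedP => C cC.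
apply/closed_subspaceP; exists (f @` (K `&` C)).
  by apply: continuous_image_closed => //; exact: compact_closedI.
apply/seteqP; split=> y; rewrite /preimage/from_subspace/=.
  by move=> [[x [Kx Cx] <-] _]; split; [rewrite fK|exists x].
by move=> [Cgy [x Kx fxy]]; move: Cgy; rewrite -fxy fK// => Cx; split; exists x.
Qed.

(** The preimage of a closed set [C] under [z] is the preimage under [f] of the
    image under [p] of the part of [C] in [K], which is closed by compactness. *)
Lemma compact_lift_continuous (X U W : topologicalType) (K : set U)
    (p : U -> W) (f : X -> W) (z : X -> U) :
  hausdorff_space W -> compact K -> continuous p -> set_inj K p ->
  continuous f -> (forall x, K (z x)) -> (forall x, p (z x) = f x) ->
  continuous z.
Proof.
move=> hW cK cp injp cf Kz pz; apply/continuous_closedP => C cC.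
rewrite (_ : z @^-1` C = f @^-1` (p @` (K `&` C))).
  have /continuous_closedP := cf; apply.
  by apply: continuous_image_closed => //; exact: compact_closedI.
apply/seteqP; split=> x /=; first by move=> Czx; exists (z x).
by move=> [u [Ku Cu]]; rewrite -pz => /injp <-; rewrite ?inE.
Qed.

(** * Integer vectors and the geometry of the frontiers *)

Section IntegerVectors.
Variables (R : realType) (d : nat).
Local Notation iv := (@intvec R d).

Lemma intvecD m n : iv (m + n) = iv m + iv n.
Proof. by apply/rowP => i; rewrite !mxE intrD. Qed.

Lemma intvecN m : iv (- m) = - iv m.
Proof. by apply/rowP => i; rewrite !mxE intrN. Qed.

Lemma intvecZ (j : int) m : iv (j *: m) = j%:~R *: iv m.
Proof. by apply/rowP => i; rewrite !mxE intrM. Qed.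

Lemma intvec0 : iv 0 = 0.
Proof. by apply/rowP => i; rewrite !mxE. Qed.

Lemma norm_rowP (v : 'rV[R]_d) (t : R) : 0 <= t ->
  `|v| <= t <-> forall i, `|v 0 i| <= t.
Proof.
move=> t0; have -> : `|v| = mx_norm v by [].
rewrite mx_normrE; split=> [vt i|vt].
  apply: le_trans vt.
  exact: (le_bigmax 0 (fun ij : 'I_1 * 'I_d => `|v ij.1 ij.2|) (0, i)).
by apply: bigmax_le => // -[j i] _ /=; rewrite (ord1 j).
Qed.

Lemma intvec_round (v : 'rV[R]_d) : exists n, `|iv n - v| <= 1.
Proof.
exists (\row_i Num.floor (v 0 i)); apply/(norm_rowP _ ler01) => i.
rewrite !mxE; have := floor_le (v 0 i); have := floorD1_gt (v 0 i).
rewrite intrD ler_norml; set f := _%:~R; lra.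
Qed.

Lemma norm_intr_le (z : int) (N : nat) : (`|z%:~R : R| <= N%:R) = (`|z| <= N%:Z).
Proof. by rewrite -intr_norm pmulrn ler_int. Qed.

(** The piece split off is [e] with its coordinates clipped to [-1, 1]. *)
Lemma intvec_split (N : nat) e : `|iv e| <= N.+1%:R ->
  exists e', `|iv e'| <= N%:R /\ `|iv (e - e')| <= 1.
Proof.
move=> e_le; have eN := (norm_rowP _ (ler0n _ _)).1 e_le.
exists (\row_i (e 0 i - sgz (e 0 i))); split;
  [apply/(norm_rowP _ (ler0n _ _)) => i|apply/(norm_rowP _ ler01) => i].
  have := eN i; rewrite !mxE !norm_intr_le.
  by case: (sgzP (e 0 i)) => He; lia.
rewrite !mxE opprB addrC subrK -(mulr1n 1) norm_intr_le.
by case: (sgzP (e 0 i)).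
Qed.

Lemma euclidean_dist_le (u v : 'rV[R]_d) :
  `|u - v| <= euclidean_dist u v /\
  euclidean_dist u v <= Num.sqrt (d%:R * `|u - v| ^+ 2).
Proof.
have e0 : 0 <= \sum_(i < d) (u 0 i - v 0 i) ^+ 2.
  by apply: sumr_ge0 => i _; exact: sqr_ge0.
have coord := (norm_rowP _ (normr_ge0 (u - v))).1 (lexx _).
split.
  apply/(norm_rowP _ (sqrtr_ge0 _)) => i; rewrite !mxE.
  rewrite -sqrtr_sqr ler_sqrt// (bigD1 i)//= lerDl.
  by apply: sumr_ge0 => l _; exact: sqr_ge0.
rewrite ler_sqrt ?mulr_ge0 ?sqr_ge0//.
rewrite -[leLHS]/(\sum_(i < d) _) (@le_trans _ _ (\sum_(i < d) `|u - v| ^+ 2))//.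
  apply: ler_sum => i _; have := coord i; rewrite !mxE => uv.
  by rewrite -real_normK ?num_real// lerXn2r ?nnegrE.
by rewrite sumr_const card_ord mulr_natl.
Qed.

(** With [near_thickening], this replaces Euclidean thickenings by
    neighbourhoods for the sup norm.  The infimum that defines a thickening
    need not be attained, whence the additional unit. *)
Lemma thickening_near (F : set 'rV[R]_d) t w : thickening F t w ->
  exists2 z, F z & `|w - z| <= t + 1.
Proof.
rewrite /thickening /= => inf_le.
have : (ereal_inf [set (euclidean_dist w z)%:E | z in F] < (t + 1)%:E)%E.
  by rewrite (le_lt_trans inf_le)// lte_fin ltrDl.
move=> /ereal_inf_lt[_ [z Fz <-]]; rewrite lte_fin => wz.
exists z => //; have [uv _] := euclidean_dist_le w z; lra.
Qed.

Lemma near_thickening (F : set 'rV[R]_d) t w z : F z -> `|w - z| <= t ->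
  thickening F (Num.sqrt (d%:R * t ^+ 2)) w.
Proof.
move=> Fz wz; rewrite /thickening /=.
apply: (@le_trans _ _ (euclidean_dist w z)%:E).
  by apply: ereal_inf_lbound; exists z.
rewrite lee_fin; have [_ wz2] := euclidean_dist_le w z; apply: (le_trans wz2).
rewrite ler_sqrt; last by rewrite mulr_ge0 ?sqr_ge0.
rewrite ler_wpM2l ?ler0n// lerXn2r ?nnegrE//.
exact: le_trans wz.
Qed.

End IntegerVectors.

Lemma floor_add2_bounds (R : realType) (r : R) : r + 1 < (Num.floor r + 2)%:~R /\
  (Num.floor r + 2)%:~R <= r + 2.
Proof.
have := floor_le r; have := floorD1_gt r; rewrite !intrD.
set f := (Num.floor r)%:~R; lra.
Qed.

(** The graph of [g] is a hyperbola with asymptotic slopes [- eps] and [eps];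
    [L] is so large that over a distance [M] the graph rises at most one unit
    above its tangent.  The estimate is the inequality between arithmetic and
    geometric means for [g s] and [g (s + a)]. *)
Lemma hyperbola_tangent (R : realType) (eps L M : R) : 0 <= M ->
  L = eps ^+ 2 * M ^+ 2 + 1 ->
  let g s := Num.sqrt (eps ^+ 2 * s ^+ 2 + L ^+ 2) in
  forall s a, `|a| <= M ->
    [/\ 0 < g s, eps * `|s| <= g s & g (s + a) <= g s + eps ^+ 2 * s / g s * a + 1].
Proof.
move=> M0 LE g s a aM.
have sq0 (r r' : R) : 0 <= r ^+ 2 * r' ^+ 2.
  by apply: mulr_ge0; exact: sqr_ge0.
have L1 : 1 <= L by rewrite LE lerDr sq0.
have g2 r : g r ^+ 2 = eps ^+ 2 * r ^+ 2 + L ^+ 2.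
  by rewrite sqr_sqrtr//; apply: addr_ge0 => //; exact: sqr_ge0.
have gL r : L <= g r.
  rewrite -(@ler_pXn2r _ 2)// ?nnegrE ?sqrtr_ge0//; last lra.
  by rewrite g2 lerDr sq0.
have g0 : 0 < g s by have := gL s; lra.
split=> //.
  have [e0|e0] := lerP 0 (eps * `|s|); last lra.
  rewrite -(@ler_pXn2r _ 2)// ?nnegrE ?sqrtr_ge0//.
  by rewrite g2 exprMn real_normK ?num_real// lerDl sqr_ge0.
have aM2 : eps ^+ 2 * a ^+ 2 <= L.
  rewrite LE (@le_trans _ _ (eps ^+ 2 * M ^+ 2))// ?lerDl//.
  by rewrite ler_wpM2l ?sqr_ge0// -[a ^+ 2]real_normK ?num_real// ler_pXn2r ?nnegrE.
have -> : eps ^+ 2 * s / g s * a = (eps ^+ 2 * s * a) / g s by ring.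
have : 0 <= (g s - g (s + a)) ^+ 2 by exact: sqr_ge0.
rewrite sqrrB !g2 => amgm.
rewrite -lerBlDr -lerBlDl ler_pdivlMr//.
have := gL s; have := g2 s; rewrite expr2.
set G := g s in amgm g0 *; set G' := g _ in amgm *.
by move: amgm; rewrite -mulr_natl; nra.
Qed.

(** A point [(a, b)] of the disc of radius [rho] which leaves it by a unit step
    to the right, and also by a unit step down, is close to the lower right arc
    of the circle.  The vector [(r, 1 - r)] is tangent to the circle at [(a, b)]
    up to a bounded error; so after [j] steps in the inward direction [(-1, 1)],
    moving a distance up to [Q] along the tangent does not lead out of the disc,
    nor does a further displacement [b'] that does not undo these steps.  The
    circle deviates from its tangent by about [Q ^ 2 / rho], which is why [rho]
    is quadratic in [Q]. *)
Lemma tangent_step (R : realType) (Q rho a b : R) : 1 <= Q ->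
  rho = 7 * Q ^+ 2 + 2 * Q + 2 ->
  a ^+ 2 + b ^+ 2 <= rho ^+ 2 -> rho ^+ 2 < (a + 1) ^+ 2 + b ^+ 2 ->
  rho ^+ 2 < a ^+ 2 + (b - 1) ^+ 2 ->
  exists r, [/\ 0 <= r, r <= 1 & forall a' b' j : R,
    `|a'| <= Q -> 2 <= j -> j <= Q -> 2 <= j + b' -> j + b' <= 2 * Q ->
    (a + 1 - j + a' * r) ^+ 2 + (b + j + a' * (1 - r) + b') ^+ 2 <= rho ^+ 2].
Proof.
move=> Q1 rhoE ab ab1 ab2.
have rho0 : 0 <= rho by have := sqr_ge0 Q; lra.
have a12 : - 1 / 2 < a by nra.
have b12 : b < 1 / 2 by nra.
(* A displacement [(x, y)] whose inward component exceeds the second order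
   terms stays in the disc; [S] is the distance to the centre, up to a factor
   and an additive constant. *)
have close (S x y : R) : rho - 3 / 2 <= S -> `|x| <= 2 * Q -> `|y| <= 3 * Q ->
    a * x + b * y <= - S + 2 * Q -> (a + x) ^+ 2 + (b + y) ^+ 2 <= rho ^+ 2.
  rewrite !ler_norml => Srho /andP[x1 x2] /andP[y1 y2] abxy.
  have x3 : x ^+ 2 <= 4 * Q ^+ 2 by nra.
  have y3 : y ^+ 2 <= 9 * Q ^+ 2 by nra.
  nra.
have far (r a' b' j : R) : 0 <= r -> r <= 1 -> `|a'| <= Q ->
    2 <= j -> j <= Q -> 2 <= j + b' -> j + b' <= 2 * Q ->
    `|1 - j + a' * r| <= 2 * Q /\ `|j + b' + a' * (1 - r)| <= 3 * Q.
  move=> r0 r1; rewrite !ler_norml => /andP[a1 a2] j2 jQ jb2 jbQ.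
  by split; apply/andP; split; nra.
have E (r a' b' j : R) : (a + 1 - j + a' * r) ^+ 2 + (b + j + a' * (1 - r) + b') ^+ 2 =
    (a + (1 - j + a' * r)) ^+ 2 + (b + (j + b' + a' * (1 - r))) ^+ 2 by ring.
(* Beyond the ends of the arc the tangent is replaced by the end of the
   segment of directions. *)
have [a0|a0] := lerP 0 a; have [b0|b0] := lerP b 0.
- have S : rho - 3 / 2 <= a - b by nra.
  have S0 : 0 < a - b by have := sqr_ge0 Q; lra.
  have r0 : 0 <= - b / (a - b) by apply: divr_ge0; lra.
  have r1 : - b / (a - b) <= 1 by rewrite ler_pdivrMr// mul1r; lra.
  exists (- b / (a - b)); split=> // a' b' j aQ j2 jQ jb2 jbQ.
  rewrite E; have [f1 f2] := far _ a' b' j r0 r1 aQ j2 jQ jb2 jbQ.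
  apply: (close (a - b)) => //.
  have -> : a * (1 - j + a' * (- b / (a - b))) + b * (j + b' + a' * (1 - - b / (a - b))) =
     a * (1 - j) + b * (j + b') by field; rewrite gt_eqF.
  nra.
- have S : rho - 3 / 2 <= a by nra.
  exists 0; split=> // a' b' j aQ j2 jQ jb2 jbQ.
  rewrite E; have [f1 f2] := far _ a' b' j (lexx _) ler01 aQ j2 jQ jb2 jbQ.
  apply: (close a) => //; rewrite subr0 mulr1 mulr0 addr0.
  move: aQ; rewrite ler_norml => /andP[a1 a2]; nra.
- have S : rho - 3 / 2 <= - b by nra.
  exists 1; split=> // a' b' j aQ j2 jQ jb2 jbQ.
  rewrite E; have [f1 f2] := far _ a' b' j ler01 (lexx _) aQ j2 jQ jb2 jbQ.
  apply: (close (- b)) => //; rewrite subrr mulr0 addr0 mulr1.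
  move: aQ; rewrite ler_norml => /andP[a1 a2]; nra.
- by exfalso; nra.
Qed.

(** * Textile systems *)

Section Coding.
Variables (X : topologicalType) (tau : homeo X) (A : finType).
Variable theta : X -> fullshift A.
Hypothesis theta_shift : forall x, theta (tau x) = shift_map (theta x).

Lemma coding_homeo_inv x : theta x = shift_map (theta (homeo_inv tau x)).
Proof. by rewrite -theta_shift homeo_invK. Qed.

Lemma coding_coordinate (j : int) x : theta x j = theta (zexpg tau j x) 0.
Proof.
have pos (i : nat) (l : int) y : theta ((tau ^+ i)%g y) l = theta y (l + i%:Z).
  elim: i l => [|i IHi] l; first by rewrite addr0.
  by rewrite expgS /= theta_shift /shift_map IHi -addrA -intS.
case: j => i /=; first by rewrite pos add0r.
have := pos i.+1 (Negz i) ((tau ^- i.+1)%g x).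
by rewrite NegzE addNr /= homeo_invK.
Qed.

End Coding.

Section Transducer.
Variables (X : topologicalType) (tau psi : homeo X).

(** Here [lam] is the bottom label and [v] the right vertex of the square at
    the origin.  In a weakly left-resolving system these two determine the
    square, hence also its left vertex and its top label. *)
Lemma pL_transducer : essentially_weakly pL tau psi ->
  exists (A V : finType) (lam : X -> A) (v : X -> V),
    [/\ locally_constant lam, locally_constant v,
        forall x y, (forall j : int, lam (zexpg tau j x) = lam (zexpg tau j y)) -> x = y &
        forall x y, lam x = lam y -> v x = v y ->
          v (homeo_inv tau x) = v (homeo_inv tau y) /\ lam (psi x) = lam (psi y)].
Proof.
move=> [A [Y [phi [theta [subY [_ weakphi] [ctheta [thetaY _ _] [theta' [_ thetaK]]] thetatau thetapsi]]]]].
have [G [B [Gam [T [Z [resT [[closedZ shiftZ] ZGam] [injZ pZ] _ phiZ]]]]]] := weakphi.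
pose p := hom_map (textile_p T).
have /choice[z zP] x : exists z, Z z /\ p z = theta x.
  have [z Zz pz] : (hom_map (textile_p T) @` Z) (theta x).
    by rewrite pZ; exact: thetaY.
  by exists z.
have z_tau x : z (tau x) = shift_map (z x).
  have [Zz pz] := zP x; have [Zz' pz'] := zP (tau x).
  apply: injZ; rewrite ?inE//; first by rewrite -shiftZ; exists (z x).
  by rewrite [LHS]pz' thetatau -pz.
have cZ : compact Z.
  exact: subclosed_compact closedZ (@fullshift_compact B) _.
have cz : continuous z.
  apply: (compact_lift_continuous (@fullshift_hausdorff A) cZ (@hom_map_continuous _ _ _ _ _) injZ ctheta).
    by move=> x; have [] := zP x.
  by move=> x; have [] := zP x.
exists A, (vertex Gam), (fun x => theta x 0), (fun x => term Gam (z x 0)); split.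
- exact: (locally_constant_precomp ctheta (coordinate_locally_constant 0)).
- exact/(locally_constant_comp (term Gam))/(locally_constant_precomp cz (coordinate_locally_constant 0)).
- move=> x y xy; apply: (can_inj thetaK); apply/funext => j.
  by rewrite (coding_coordinate thetatau j x) (coding_coordinate thetatau j y).
move=> x y lamxy vxy.
have zxy : z x 0 = z y 0.
  apply: resT; congr pair => //.
  have -> : hom_arc (textile_p T) (z x 0) = theta x 0 by rewrite -(zP x).2.
  by rewrite lamxy -(zP y).2.
have vinv u : term Gam (z (homeo_inv tau u) 0) = init Gam (z u 0).
  have [Zz _] := zP (homeo_inv tau u).
  by rewrite (ZGam _ Zz) add0r -[z u]/(z u) -{2}(homeo_invK tau u) z_tau.
split; first by rewrite !vinv zxy.
have lampsi u : theta (psi u) 0 = hom_arc (textile_q T) (z u 0).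
  by have [Zz pz] := zP u; rewrite thetapsi -pz phiZ.
by rewrite !lampsi zxy.
Qed.

End Transducer.

Section Duality.

Definition rev_seq (A : finType) (a : fullshift A) : fullshift A :=
  fun j => a (- j).

Lemma rev_seqK (A : finType) : involutive (@rev_seq A).
Proof. by move=> a; apply/funext => j; rewrite /rev_seq opprK. Qed.

Lemma rev_seq_continuous (A : finType) : continuous (@rev_seq A).
Proof. by apply: continuous_coordinates => j; exact: coordinate_locally_constant. Qed.

Lemma rev_seq_shift (A : finType) (a : fullshift A) :
  shift_map (rev_seq (shift_map a)) = rev_seq a.
Proof. by apply/funext => j; rewrite /shift_map /rev_seq opprD subrK. Qed.

Lemma rev_seq_subshift (A : finType) (Y : set (fullshift A)) :
  is_subshift Y -> is_subshift (@rev_seq A @` Y).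
Proof.
move=> [cY sY]; split.
  rewrite (_ : _ @` _ = @rev_seq A @^-1` Y).
    by move: (@rev_seq_continuous A) => /continuous_closedP; exact.
  apply/seteqP; split=> [_ [a Ya <-]|a Ya] /=; first by rewrite rev_seqK.
  by exists (rev_seq a); rewrite ?rev_seqK.
apply/seteqP; split=> [_ [_ [a + <-] <-]|_ [a Ya <-]].
  by rewrite -{1}sY => -[b Yb <-]; exists b; rewrite ?rev_seq_shift.
exists (rev_seq (shift_map a)); last exact: rev_seq_shift.
by exists (shift_map a); rewrite // -sY; exists a.
Qed.

Definition reverse_graph (A : finType) (G : graph A) : graph A :=
  @Graph A (vertex G) (@term A G) (@init A G).

Definition reverse_hom (B A : finType) (Gam : graph B) (G : graph A)
    (h : graph_hom Gam G) : graph_hom (reverse_graph Gam) (reverse_graph G) :=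
  @GraphHom B A (reverse_graph Gam) (reverse_graph G) (hom_arc h) (hom_vertex h)
    (hom_term h) (hom_init h).

Lemma rev_seq_hom_map (B A : finType) (Gam : graph B) (G : graph A)
    (h : graph_hom Gam G) b :
  hom_map (reverse_hom h) (rev_seq b) = rev_seq (hom_map h b).
Proof. by []. Qed.

Definition dual_type (P : resolving_type) :=
  match P with pL => qR | qR => pL end.

Variable X : topologicalType.
Hypothesis X_compact : compact [set: X].
Variables tau psi : homeo X.
Hypothesis tau_psi : forall x, psi (tau x) = tau (psi x).

(** Turning the squares of a textile system by half a turn exchanges [p] with
    [q] and initial with terminal vertices; this exchanges the two kinds of
    resolving systems and replaces both homeomorphisms by their inverses. *)
Lemma essentially_weakly_dual P : essentially_weakly P tau psi ->
  essentially_weakly (dual_type P) (homeo_invg tau) (homeo_invg psi).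
Proof.
move=> [A [Y [phi [theta [subY [_ weakphi] [ctheta [thetaY _ Ytheta] [theta' [_ thetaK]]] thetatau thetapsi]]]]].
have [G [B [Gam [T [Z [resT [subZ ZGam] [injZ pZ] _ phiZ]]]]]] := weakphi.
pose p := textile_p T; pose q := textile_q T.
pose theta2 := @rev_seq A \o theta.
pose theta2' := theta' \o @rev_seq A.
have theta2K : cancel theta2 theta2' by move=> x; rewrite /theta2' /theta2 /= rev_seqK.
have ctheta2 : continuous theta2.
  by move=> x; apply: continuous_comp; [exact: ctheta|exact: rev_seq_continuous].
have YE : Y = range theta.
  by apply/seteqP; split=> [a /Ytheta//|_ [x _ <-]]; exact: thetaY.
have Y2E : @rev_seq A @` Y = range theta2.
  by rewrite YE; apply/seteqP; split=> [_ [_ [x _ <-] <-]|_ [x _ <-]];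
     [exists x|exists (theta x)].
have theta2tau x : theta2 (homeo_inv tau x) = shift_map (theta2 x).
  by rewrite /theta2 /= (coding_homeo_inv thetatau x) rev_seq_shift.
have tau_psi' x : homeo_inv psi (homeo_inv tau x) = homeo_inv tau (homeo_inv psi x).
  apply: (can_inj (homeo_funK tau)); apply: (can_inj (homeo_funK psi)).
  by rewrite homeo_invK tau_psi homeo_invK homeo_invK homeo_invK.
have ctheta2' : {within @rev_seq A @` Y, continuous theta2'}.
  rewrite Y2E.
  exact: (compact_inverse_continuous (@fullshift_hausdorff A) X_compact ctheta2).
have pqZ z : Z z -> exists2 x, hom_map p z = theta x & hom_map q z = theta (psi x).
  move=> Zz; have : Y (hom_map p z) by rewrite -pZ; exists z.
  rewrite YE => -[x _ px]; exists x => //.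
  by rewrite thetapsi px -phiZ.
exists A, (@rev_seq A @` Y), (theta2 \o homeo_inv psi \o theta2'), theta2; split.
- exact: rev_seq_subshift.
- split.
    split.
    - move=> a; apply: (@continuous_comp (subspace (@rev_seq A @` Y)) X _ theta2'
        (theta2 \o homeo_inv psi)).
        exact: ctheta2'.
      by apply: continuous_comp; [exact: homeo_inv_continuous|exact: ctheta2].
    - by rewrite Y2E => a _; exists (homeo_inv psi (theta2' a)).
    - rewrite Y2E => _ [x _ <-] /=.
      by rewrite -theta2tau !theta2K tau_psi' theta2tau.
  exists (reverse_graph G), B, (reverse_graph Gam),
    (Textile (reverse_hom q) (reverse_hom p)), (@rev_seq B @` Z); split.
  - by move: resT; case: (P).
  - split; first exact: rev_seq_subshift.
    move=> _ [z Zz <-] j /=; rewrite /rev_seq opprD.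
    by have := ZGam _ Zz (- j - 1); rewrite subrK.
  - split.
      move=> _ _ /set_mem[z Zz <-] /set_mem[z' Zz' <-].
      rewrite /= !rev_seq_hom_map => /(can_inj (@rev_seqK A)) qzz'; congr rev_seq.
      have [x px qx] := pqZ z Zz; have [x' px' qx'] := pqZ z' Zz'.
      apply: injZ; rewrite ?inE// [LHS]px [RHS]px'; congr theta.
      apply: (can_inj (homeo_funK psi)); apply: (can_inj thetaK).
      by rewrite -qx -qx'.
    apply/seteqP; split=> [_ [_ [z Zz <-] <-]|_ [a Ya <-]] /=.
      have [x _ qx] := pqZ z Zz; exists (hom_map q z) => //.
      by rewrite qx; exact: thetaY.
    have [x _ xa] : range theta a by rewrite -YE.
    have : Y (theta (homeo_inv psi x)) by exact: thetaY.
    rewrite -pZ => -[z Zz pz]; have [x' px' qx'] := pqZ z Zz.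
    exists (rev_seq z); first by exists z.
    rewrite rev_seq_hom_map qx' (_ : x' = homeo_inv psi x); first by rewrite homeo_invK xa.
    by apply: (can_inj thetaK); rewrite -px'.
  - move=> _ [_ [z Zz <-] <-]; exists (hom_map p z) => //.
    by rewrite -pZ; exists z.
  - move=> _ [z Zz <-]; rewrite /= !rev_seq_hom_map.
    have [x px qx] := pqZ z Zz.
    by rewrite qx px -[rev_seq (theta _)]/(theta2 _) theta2K homeo_funK.
- split=> //; last by exists theta2'.
  rewrite Y2E; split=> [x _|x y _ _|_ [x _ <-]]; [by exists x| |by exists x].
  exact: (can_inj theta2K).
- exact: theta2tau.
- by move=> x /=; rewrite theta2K.
Qed.

End Duality.

(** * Labels of a lattice action *)

Section Labels.
Variables (R : realType) (X : metricType R) (d : nat).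
Variable alpha : 'rV[int]_d -> homeo X.
Hypothesis X_compact : compact [set: X].
Hypothesis X_zero_dimensional : zero_dimensional X.
Hypothesis alphaD : forall m n x, alpha (m + n) x = alpha m (alpha n x).
Variables (A : finType) (P : X -> A).
Hypothesis P_lc : locally_constant P.
Local Notation iv := (@intvec R d).
Implicit Types (u v w q z : 'rV[R]_d) (m n p e : 'rV[int]_d) (x y : X).

Lemma action0 x : alpha 0 x = x.
Proof.
by apply: (can_inj (homeo_funK (alpha 0))); rewrite -alphaD addr0.
Qed.

Definition agree (x y : X) (n : 'rV[int]_d) := P (alpha n x) = P (alpha n y).

Lemma agree_shift x y p n :
  agree (alpha p x) (alpha p y) n = agree x y (n + p).
Proof. by rewrite /agree !alphaD. Qed.

Lemma label_lc n : locally_constant (fun x => P (alpha n x)).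
Proof.
exact: (locally_constant_precomp (@homeo_fun_continuous _ (alpha n)) P_lc).
Qed.

(** Packs the labels read on a bounded window into one label, so that results
    on single locally constant maps apply to windows. *)
Lemma window_label (W : 'rV[int]_d -> Prop) (N : nat) :
  (forall n, W n -> `|iv n| <= N%:R) ->
  exists (T : finType) (L : X -> T), locally_constant L /\
    forall x y, L x = L y <-> forall n, W n -> agree x y n.
Proof.
move=> WN.
pose dec (r : 'rV['I_(N + N).+1]_d) : 'rV[int]_d :=
  \row_i ((r 0 i : nat)%:Z - N%:Z).
pose Li r x := if `[< W (dec r) >] then Some (P (alpha (dec r) x)) else None.
exists {ffun 'rV['I_(N + N).+1]_d -> option A}, (fun x => [ffun r => Li r x]).
split.
  apply: locally_constant_ffun => r; rewrite /Li; case: asboolP => _ x; last exact: nearW.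
  exact: (locally_constant_comp Some (label_lc (dec r))).
move=> x y; split=> [/ffunP Lxy n Wn|agr].
  have nN i : `|n 0 i| <= N%:Z.
    have := (norm_rowP _ (ler0n _ _)).1 (WN n Wn) i.
    by rewrite mxE norm_intr_le.
  pose r : 'rV['I_(N + N).+1]_d := \row_i inord (absz (n 0 i + N%:Z)).
  have decr : dec r = n.
    apply/rowP => i; rewrite !mxE inordK; have := nN i; lia.
  have := Lxy r; rewrite !ffunE /Li decr; case: asboolP => // _.
  by case.
by apply/ffunP => r; rewrite !ffunE /Li; case: asboolP => // Wr; congr Some; exact: agr.
Qed.

Variable k : 'rV[int]_d.
Hypothesis P_generates : forall x y, (forall j : int, agree x y (j *: k)) -> x = y.

Lemma line_determines (T : Type) (L : X -> T) : locally_constant L ->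
  exists N : nat, forall x y,
    (forall j : int, `|j| <= N%:Z -> agree x y (j *: k)) -> L x = L y.
Proof.
move=> lcL.
apply: (finite_determination (f := fun (j : int) x => P (alpha (j *: k) x))
   (D := fun N j => `|j| <= N%:Z)) => //.
- by move=> j; exact: label_lc.
- by move=> m n j mn jm; rewrite (le_trans jm)// lez_nat.
- move=> x y agr; apply: P_generates => j; apply: (agr (absz j) j).
  by rewrite abszE.
Qed.

(** By compactness a segment of length [Lam] on both sides of a point determines
    its unit neighbourhood; each further unit of distance is gained at the
    expense of [Lam] at both ends, whence the linear dependence. *)
Lemma segment_determines_nat : exists Lam : nat, forall (N : nat) x y p e,
  `|iv e| <= N%:R ->
  (forall j : int, `|j| <= (Lam * N)%N%:Z -> agree x y (p + j *: k)) ->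
  agree x y (p + e).
Proof.
have [|T [L [lcL LP]]] := @window_label (fun n => `|iv n| <= 1) 1; first by [].
have [Lam LamP] := line_determines lcL.
exists Lam; elim=> [|N IHN] x y p e eN agr.
  have -> : e = 0.
    apply/rowP => i; have := (norm_rowP _ (ler0n _ _)).1 eN i.
    by rewrite !mxE norm_intr_le => ?; lia.
  by have := agr 0; rewrite scale0r; apply.
have [e' [e'N ee']] := intvec_split eN.
have -> : p + e = (e - e') + (p + e') by rewrite addrCA subrK.
rewrite -agree_shift; apply: (LP _ _).1 ee'; apply: LamP => j jLam.
rewrite agree_shift addrC addrAC; apply: IHN => // i iN.
rewrite -addrA -scalerDl; apply: agr; rewrite mulnS; lia.
Qed.

(** The same around a real vector [v], with the known labels near the points of
    a real segment. *)
Lemma segment_determines : exists2 Lam : R, 0 <= Lam &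
  forall x y (n : 'rV[int]_d) (v : 'rV[R]_d) (r : R), `|iv n - v| <= r ->
  (forall n' (b : R), `|b| <= Lam * (r + 2) -> `|iv n' - (v + b *: iv k)| <= 1 ->
     agree x y n') ->
  agree x y n.
Proof.
have [Lam LamP] := segment_determines_nat.
exists Lam%:R; first exact: ler0n.
move=> x y n v r nv agr; have [p pv] := intvec_round v.
have np : `|iv (n - p)| <= r + 1.
  rewrite intvecD intvecN; have -> : iv n - iv p = (iv n - v) - (iv p - v).
    by rewrite opprB addrA subrK.
  by rewrite (le_trans (ler_normB _ _))// lerD.
have r0 : 0 <= r + 1 by exact: le_trans np.
have -> : n = p + (n - p) by rewrite addrC subrK.
apply: (LamP (Num.truncn (r + 1)).+1).
  by rewrite (le_trans np)// ltW// truncnS_gt.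
move=> j jN; apply: (agr _ j%:~R).
  apply: le_trans (_ : (Lam * (Num.truncn (r + 1)).+1)%:R <= _).
    by rewrite norm_intr_le.
  rewrite natrM ler_wpM2l// -natr1.
  have := truncn_le (r + 1); rewrite r0 => /= tr; lra.
by rewrite intvecD intvecZ opprD addrACA subrr addr0.
Qed.

(** * Determining vectors *)

(** For [w] different from 0 this says that the line of [w] is right
    [k]-expansive; see [ER_determining]. *)
Definition determining w := exists t : R, forall x y,
  (forall n (a b : R), 0 <= b -> `|iv n - (a *: w + b *: iv k)| <= t ->
     agree x y n) -> x = y.

(** A bounded piece, of size [M], of the half-plane of [w] thickened by [t]
    determines a ball around the origin.  The radius [B t] depends on the
    thickness because it has to exceed the distance, growing with [t], to which
    the half-plane is displaced in the applications. *)
Definition locally_determining w (B : R -> R) (M : R) := exists t : R,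
  [/\ 0 <= t, t <= M & forall x y,
    (forall n (a b : R), `|a| <= M -> 0 <= b -> b <= M ->
       `|iv n - (a *: w + b *: iv k)| <= t -> agree x y n) ->
    forall n, `|iv n| <= B t -> agree x y n].

Lemma locally_determiningW w B M M' : M <= M' ->
  locally_determining w B M -> locally_determining w B M'.
Proof.
move=> MM' [t [t0 tM agr]]; exists t; split=> // [|x y agr']; first exact: le_trans MM'.
by apply: agr => n a b aM b0 bM; apply: agr'; rewrite ?(le_trans _ MM').
Qed.

(** By compactness a bounded piece of the half-plane suffices; a small change
    of [w] displaces it by at most one unit, which is absorbed by increasing the
    thickness by one. *)
Lemma determining_near w B : determining w ->
  exists M : nat, \forall w' \near w, locally_determining w' B M%:R.
Proof.
move=> [t tP]; pose t1 := Num.max t 0 + 1.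
have t0 : 0 <= Num.max t 0 by rewrite le_max lexx orbT.
have [|T [L [lcL LP]]] := @window_label
  (fun n => `|iv n| <= B t1) (Num.truncn (B t1)).+1.
  by move=> n nB; rewrite (le_trans nB)// ltW// truncnS_gt.
pose D (N : nat) n := exists a b : R, [/\ `|a| <= N%:R, 0 <= b, b <= N%:R &
  `|iv n - (a *: w + b *: iv k)| <= Num.max t 0].
have [||||N NP] := @finite_determination X _ _ _
  (fun n x => P (alpha n x)) D L X_compact; first by move=> n; exact: (label_lc n).
- move=> m n e mn [a [b [am b0 bm abt]]]; exists a, b.
  by rewrite (le_trans am) ?(le_trans bm) ?ler_nat.
- move=> x y agr; apply: tP => n a b b0 abt.
  apply: (agr (maxn (Num.truncn `|a|).+1 (Num.truncn b).+1)); exists a, b; split=> //.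
  + by rewrite (le_trans (ltW (truncnS_gt _)))// ler_nat leq_maxl.
  + by rewrite (le_trans (ltW (truncnS_gt _)))// ler_nat leq_maxr.
  + by rewrite (le_trans abt)// le_max lexx.
- exact: lcL.
pose M := maxn N (Num.truncn t1).+1.
exists M; have M1 : 0 < M.+1%:R^-1 :> R by rewrite invr_gt0.
apply: filterS (nbhsx_ballx w _ M1) => w'; rewrite -ball_normE /= => ww'.
exists t1; split=> //; rewrite ?addr_ge0//.
  by rewrite (le_trans (ltW (truncnS_gt _)))// ler_nat leq_maxr.
move=> x y agr; apply/LP; apply: NP => n [a [b [aN b0 bN nt]]].
have NM : N%:R <= M%:R :> R by rewrite ler_nat leq_maxl.
apply: (agr n a b) => //; [exact: le_trans NM|exact: le_trans NM|].
have -> : iv n - (a *: w' + b *: iv k) = (iv n - (a *: w + b *: iv k)) + a *: (w - w').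
  by apply/rowP => i; rewrite !mxE; ring.
rewrite (le_trans (ler_normD _ _))// lerD// normrZ.
apply: le_trans (_ : M.+1%:R * M.+1%:R^-1 <= _); last by rewrite divff.
apply: ler_pM => //; last exact: ltW.
by rewrite (le_trans aN)// (le_trans NM)// ler_nat.
Qed.

Lemma determiningZ w c : c != 0 -> determining w -> determining (c *: w).
Proof.
move=> c0 [t tP]; exists t => x y agr; apply: tP => n a b b0 nt.
by apply: (agr n (a / c) b) => //; rewrite scalerA divfK.
Qed.

(** The half-plane of [k] is the line of [k]. *)
Lemma determining_k : determining (iv k).
Proof.
exists 0 => x y agr; apply: P_generates => j.
apply: (agr _ j%:~R 0) => //.
by rewrite scale0r addr0 intvecZ subrr normr0.
Qed.

Lemma locally_determining_compact (g : R -> 'rV[R]_d) B lo hi :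
  continuous g -> (forall r, lo <= r -> r <= hi -> determining (g r)) ->
  exists M, forall r, lo <= r -> r <= hi -> locally_determining (g r) B M.
Proof.
move=> cg detg.
pose Q (M : nat) r := locally_determining (g r) B M%:R.
have [|M _ MP] := (compact_near_coveringP _).1 (@segment_compact R lo hi) nat \oo Q _.
  move=> r; rewrite /= in_itv/= => /andP[lor rhi].
  have [M nearM] := determining_near B (detg r lor rhi).
  exists ((g @^-1` [set w' | locally_determining w' B M%:R]), [set N | (M <= N)%N]).
    by split; [exact: cg|exists M].
  move=> [r' N] /= [r'M MN]; apply: locally_determiningW r'M.
  by rewrite ler_nat.
exists M%:R => r lor rhi; apply: (MP M (leqnn M)).
by rewrite /= in_itv/= lor rhi.
Qed.

(** The form in which local determination is used.  The label at [n], close to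
    [z], is wanted; the half-plane is based at [z + e], deeper in the region
    where labels agree.  By [segment_determines] its thickness [t] may be traded
    for a lengthening by [reach t] in both directions of [k], so that regions
    need only be known up to thickness one. *)
Lemma segment_reach : exists reach : R -> R, [/\ forall t, 0 <= reach t,
  {homo reach : t t' / t <= t'} &
  forall w B M, locally_determining w B M -> exists t, [/\ 0 <= t, t <= M &
    forall x y n z e, `|iv n - z| <= 1 -> `|iv e| <= B t ->
      (forall n' (a b : R), `|a| <= M -> - reach t <= b -> b <= M + reach t ->
         `|iv n' - (z + iv e + (a *: w + b *: iv k))| <= 1 -> agree x y n') ->
      agree x y n]].
Proof.
have [Lam Lam0 LamP] := segment_determines.
pose reach t := Num.max 0 (Lam * (t + 1 + 2)).
exists reach; split; first by move=> t; rewrite le_max lexx.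
  move=> t t' tt'; rewrite ge_max !le_max lexx /= ler_wpM2l ?orbT//; lra.
move=> w B M [t [t0 tM tP]]; exists t; split=> // x y n z e nz eB agr.
rewrite (_ : n = - e + (n + e)); last by rewrite addrC addrK.
rewrite -agree_shift; apply: tP; last by rewrite intvecN normrN.
move=> l a b aM b0 bM lt; rewrite agree_shift.
apply: (LamP _ _ _ (z + iv e + (a *: w + b *: iv k)) (t + 1)).
  rewrite !intvecD addrCA.
  have -> : iv n + (iv l + iv e) - (z + iv e + (a *: w + b *: iv k)) =
    (iv l - (a *: w + b *: iv k)) + (iv n - z).
    apply/rowP => i; rewrite !mxE; ring.
  by rewrite (le_trans (ler_normD _ _))// lerD.
move=> n' b'; have -> : z + iv e + (a *: w + b *: iv k) + b' *: iv k =
  z + iv e + (a *: w + (b + b') *: iv k) by rewrite scalerDl !addrA.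
move=> b'L n'1.
have {b'L} : `|b'| <= reach t by rewrite (le_trans b'L)// le_max lexx orbT.
rewrite ler_norml => /andP[b'l b'r].
apply: (agr n' a (b + b')) => //; lra.
Qed.

(** The region [- i <= b] grows by one unit at each step: moving the base point
    far enough along [k] brings the lengthened piece of half-plane into the
    region already known. *)
Lemma determining_of_local : exists B, forall w M,
  locally_determining w B M -> determining w.
Proof.
have [reach [reach0 _ reachP]] := segment_reach.
exists (fun t => (reach t + 2) * `|iv k|) => w M /reachP[t [t0 tM tP]].
exists 1 => x y agr.
have grow (i : nat) n (a b : R) : - i%:R <= b ->
    `|iv n - (a *: w + b *: iv k)| <= 1 -> agree x y n.
  elim: i n a b => [|i IHi] n a b ib nab.
    by apply: agr nab; rewrite -oppr0.
  have [jl jr] := floor_add2_bounds (reach t); set j := Num.floor _ + 2 in jl jr.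
  apply: (tP _ _ _ _ (j *: k) nab).
    rewrite intvecZ normrZ ler_wpM2r// ger0_norm//.
    by have := reach0 t; lra.
  move=> n' a' b' _ b'l _; rewrite intvecZ.
  have -> : a *: w + b *: iv k + j%:~R *: iv k + (a' *: w + b' *: iv k) =
    (a + a') *: w + (b + j%:~R + b') *: iv k.
    by apply/rowP => l; rewrite !mxE; ring.
  by apply: IHi; move: ib; rewrite -natr1; lra.
apply: P_generates => j; apply: (grow (absz j) _ 0 j%:~R).
  rewrite lerNl (le_trans (ler_norm _))// normrN -intr_norm.
  by rewrite pmulrn abszE.
by rewrite scale0r add0r intvecZ subrr normr0.
Qed.

Lemma determining_open w : determining w -> \forall w' \near w, determining w'.
Proof.
have [B BP] := determining_of_local => /(determining_near B)[M].
by apply: filterS => w'; exact: BP.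
Qed.

(** The hyperbola of [hyperbola_tangent], tilted by [c], bounds a region where
    the labels agree.  At each of its points the region contains, up to a bounded
    error, a large piece of the half-plane bounded by the tangent.  As the
    slopes of all tangents are determining, the frontier can be moved back one
    unit at a time, for ever. *)
Lemma hyperbola_determining q (c eps : R) : 0 <= eps ->
  (forall r : R, c - eps <= r -> r <= c + eps -> determining (q + r *: iv k)) ->
  forall x y C,
  (forall n (s b : R), c * s + eps * `|s| + C <= b ->
     `|iv n - (s *: q + b *: iv k)| <= 1 -> agree x y n) ->
  x = y.
Proof.
move=> eps0 detq x y C agr.
have [reach [reach0 _ reachP]] := segment_reach.
(* The base point is moved by at most [reach t + 3] times [k]. *)
pose B t := (reach t + 3) * `|iv k|.
have [|M MP] := locally_determining_compact B _ detq.
  by move=> r; apply: cvgD; [exact: cvg_cst|apply: cvgZr_tmp; exact: cvg_id].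
have M0 : 0 <= M.
  have [||t [t0 tM _]] := MP c; [lra|lra|exact: le_trans tM].
(* The frontier at stage [i] is the graph of [c s + g s + C - i]. *)
pose L := eps ^+ 2 * M ^+ 2 + 1.
pose g s := Num.sqrt (eps ^+ 2 * s ^+ 2 + L ^+ 2).
have gP := @hyperbola_tangent R eps L M M0 erefl; rewrite -/g /= in gP.
have grow (i : nat) n (s b : R) : c * s + g s + C - i%:R <= b ->
    `|iv n - (s *: q + b *: iv k)| <= 1 -> agree x y n.
  elim: i n s b => [|i IHi] n s b ib nsb.
    apply: agr nsb; apply: le_trans ib; rewrite subr0.
    by have [|_ ? _] := gP s 0; [rewrite normr0|lra].
  have [|gs0 gs _] := gP s 0; first by rewrite normr0.
  (* The slope of the tangent at [s]. *)
  pose r := c + eps ^+ 2 * s / g s.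
  have : `|eps ^+ 2 * s / g s| <= eps.
    rewrite normrM normrV ?unitfE ?gt_eqF// [`|g s|]gtr0_norm// ler_pdivrMr//.
    rewrite normrM ger0_norm ?sqr_ge0// expr2 -mulrA ler_wpM2l//.
  rewrite ler_norml => /andP[rl rr].
  have [t [t0 tM tP]] : exists t, [/\ 0 <= t, t <= M & forall x y n z e,
      `|iv n - z| <= 1 -> `|iv e| <= B t ->
      (forall n' (a b : R), `|a| <= M -> - reach t <= b -> b <= M + reach t ->
         `|iv n' - (z + iv e + (a *: (q + r *: iv k) + b *: iv k))| <= 1 ->
         agree x y n') -> agree x y n].
    by apply: reachP; apply: MP; rewrite /r; lra.
  have [jl jr] := floor_add2_bounds (reach t + 1); set j := Num.floor _ + 2 in jl jr.
  apply: (tP _ _ _ _ (j *: k) nsb).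
    rewrite intvecZ normrZ ler_wpM2r// ger0_norm//; have := reach0 t; lra.
  move=> n' a b' aM b'l _; rewrite intvecZ.
  have -> : s *: q + b *: iv k + j%:~R *: iv k +
      (a *: (q + r *: iv k) + b' *: iv k) =
    (s + a) *: q + (b + j%:~R + a * r + b') *: iv k.
    by apply/rowP => l; rewrite !mxE; ring.
  apply: IHi; have [_ _ ga] := gP s a aM; move: ib; rewrite -natr1 /r; nra.
apply: P_generates => j.
pose i := (Num.truncn (g 0 + C - j%:~R)).+1.
apply: (grow i _ 0 j%:~R).
  have := truncnS_gt (g 0 + C - j%:~R); rewrite -/i mulr0; lra.
by rewrite scale0r add0r intvecZ subrr normr0.
Qed.

(** * Segments of determining vectors *)

(** Labels on the half-plane of [u = (1 - s) k + s w] spread at bounded speed to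
    those parameters [(s', b)] in the plane of [k] and [q = s w'] that satisfy
    [c s' + c |s'| + C <= b], where [c = 1 - s]; and the slopes between 0 and
    [2 c] over [q] belong to the positive multiples of the segment from [k] to
    [w'].  The vector [u] may be 0: this is what keeps negative multiples of [k]
    out of the closure of [star]. *)
Lemma determining_limit w s : 0 < s -> s < 1 ->
  (forall eta : R, 0 < eta -> exists w', `|w' - w| < eta /\
     forall r, 0 <= r -> r <= 1 -> determining ((1 - r) *: iv k + r *: w')) ->
  determining ((1 - s) *: iv k + s *: w).
Proof.
move=> s0 s1 near_w; pose c := 1 - s.
have [Lam Lam0 LamP] := segment_determines.
(* The distance to [w'] costs at most [c |s'|] in the direction of [k]. *)
have eta0 : 0 < c / (Lam + 1) by apply: divr_gt0; rewrite ?/c; lra.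
have [w' [w'w detw']] := near_w _ eta0.
have LamD : Lam * (s * `|w' - w|) <= c.
  have : `|w' - w| * (Lam + 1) <= c by rewrite -ler_pdivlMr ?ltW//; lra.
  have v0 := normr_ge0 (w' - w).
  have : 0 <= Lam * `|w' - w| * (1 - s) by rewrite !mulr_ge0//; lra.
  nra.
exists 1 => x y agr.
apply: (@hyperbola_determining (s *: w') c c _ _ _ _ (3 * Lam)); first by rewrite /c; lra.
  move=> r r0 _; have sr0 : 0 < s + r by move: r0; lra.
  (* Up to the factor [s + r], a point of the segment from [k] to [w']. *)
  have -> : s *: w' + r *: iv k =
      (s + r) *: ((1 - s / (s + r)) *: iv k + (s / (s + r)) *: w').
    apply/rowP => i; rewrite !mxE; field; lra.
  apply: determiningZ; first by rewrite gt_eqF.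
  apply: detw'; first by rewrite divr_ge0 ?ltW.
  by rewrite ler_pdivrMr// mul1r; move: r0; lra.
move=> n s' b sb nsb.
apply: (LamP _ _ _ (s' *: ((1 - s) *: iv k + s *: w) + (b - s' * c) *: iv k)
   (1 + `|s'| * (s * `|w' - w|))).
  have -> : iv n - (s' *: ((1 - s) *: iv k + s *: w) + (b - s' * c) *: iv k) =
      iv n - (s' *: (s *: w') + b *: iv k) + s' *: (s *: (w' - w)).
    by apply/rowP => i; rewrite !mxE /c; ring.
  rewrite (le_trans (ler_normD _ _))// lerD// !normrZ.
  by rewrite (gtr0_norm s0).
move=> n' b' b'L n'b'; apply: (agr n' s' (b - s' * c + b')); last first.
  by rewrite [(_ + b') *: _]scalerDl addrA.
move: b'L; rewrite ler_norml => /andP[b'L _].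
have : `|s'| * (Lam * (s * `|w' - w|)) <= `|s'| * c by rewrite ler_wpM2l.
move: sb b'L; nra.
Qed.

(** The half-plane of 0 is a forward ray in the direction of [k]. *)
Lemma forward_generates : determining 0 ->
  forall x y, (forall j : nat, agree x y (j%:Z *: k)) -> x = y.
Proof.
move=> [t tP] x y agr.
have [Lam LamP] := segment_determines_nat.
pose N := (Num.truncn (t + `|iv k|)).+1; pose J := (Lam * N)%N%:Z *: k.
apply: (can_inj (homeo_funK (alpha J))); apply: tP => n a b b0.
rewrite scaler0 add0r => nb; rewrite agree_shift.
have : (0 <= Num.floor b) by rewrite floor_ge0.
have := floor_le b; have := floorD1_gt b; rewrite intrD.
set i := Num.floor b => bi ib i0.
rewrite (_ : n + J = (i *: k + J) + (n - i *: k)); last by rewrite [RHS]addrC addrA subrK.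
apply: (LamP N).
  rewrite intvecD intvecN intvecZ.
  have -> : iv n - i%:~R *: iv k = (iv n - b *: iv k) + (b - i%:~R) *: iv k.
    by apply/rowP => l; rewrite !mxE; ring.
  rewrite (le_trans (ler_normD _ _))// (@le_trans _ _ (t + `|iv k|))//; last first.
    by rewrite ltW// truncnS_gt.
  rewrite lerD// normrZ -[leRHS]mul1r ler_wpM2r// ger0_norm; lra.
move=> j jN; rewrite /J -!scalerDl.
have -> : i + (Lam * N)%N%:Z + j = (absz (i + (Lam * N)%N%:Z + j))%:Z by lia.
exact: agr.
Qed.

(** If forward orbits of labels determined the points, words of bounded length
    would determine the letter preceding them.  A word in the far future would
    then determine all earlier ones, so that no finite set of points could have
    more elements than there are words, and [X] would be finite. *)
Lemma not_determining0 : infinite_set [set: X] -> ~ determining 0.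
Proof.
move=> X_infinite /forward_generates fwd.
have kS (j : nat) : j%:Z *: k + k = j.+1%:Z *: k.
  by rewrite -{2}[k]scale1r -scalerDl intS addrC.
pose f (j : nat) x := P (alpha (j.+1%:Z *: k) x).
have [||||N NP] := @finite_determination X nat _ _ f (fun N j => (j <= N)%N) P X_compact.
- by move=> j; exact: (label_lc _).
- by move=> m n i mn im; exact: leq_trans mn.
- move=> x y agr; apply: (can_inj (homeo_funK (alpha k))); apply: fwd => j.
  by rewrite agree_shift kS; exact: agr (leqnn j).
- exact: P_lc.
(* Time [n] stands for the labels at times [n + 1] to [n + N + 1]. *)
pose word (n : nat) x := [ffun j : 'I_N.+1 => f (n + j)%N x].
have word_pred (n : nat) x y : word n.+1 x = word n.+1 y -> word n x = word n y.
  move=> /ffunP wxy; apply/ffunP => -[[|j] jN]; rewrite !ffunE /=; last first.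
    by have := wxy (Ordinal (ltnW jN)); rewrite !ffunE /= addnS addSn.
  rewrite addn0; apply: NP => j jN'.
  have := wxy (Ordinal (jN' : (j < N.+1)%N)); rewrite !ffunE /= /f -!alphaD -scalerDl.
  by rewrite (_ : j.+1%:Z + n.+1%:Z = (n.+1 + j).+1%:Z)//; lia.
have word_le (m n : nat) x y : (m <= n)%N -> word n x = word n y -> word m x = word m y.
  move=> /subnK <-; elim: (n - m)%N => // i IHi.
  by rewrite addSn => /word_pred/IHi.
have word_inj x y : (forall n : nat, word n x = word n y) -> x = y.
  move=> wxy; apply: (can_inj (homeo_funK (alpha k))); apply: fwd => j.
  have /ffunP/(_ ord0) := wxy j; rewrite !ffunE addn0.
  by rewrite agree_shift kS.
have /choice[h hP] (z : X * X) :
    exists n : nat, z.1 <> z.2 -> word n z.1 <> word n z.2.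
  have [|] := pselect (exists n : nat, word n z.1 <> word n z.2).
    by move=> [n nP]; exists n.
  by move=> /forallNP nP; exists 0%N => zz; case: zz; apply: word_inj => n; exact: contrapT (nP n).
have [F _ F_large] := @infinite_set_fset _ [set: X] #|{ffun 'I_N.+1 -> A}|.+1 X_infinite.
(* At time [n] all pairs of distinct points of [s] have been told apart. *)
pose s : seq X := finmap.enum_fset F.
pose n : nat := \max_(x <- s) \max_(y <- s) h (x, y).
have word_n : {in s &, injective (word n)}.
  move=> x y xs ys wxy; apply: contrapT => xy; apply: (hP (x, y) xy) => /=.
  apply: word_le wxy; apply: leq_trans (leq_bigmax_seq _ xs _) => //.
  exact: (@leq_bigmax_seq X s xpredT (fun y => h (x, y)) y ys).
have : uniq [seq word n x | x <- s] by rewrite map_inj_in_uniq //; exact: finmap.fset_uniq.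
move=> /card_uniqP; rewrite size_map => cardF.
have := max_card [in [seq word n x | x <- s]]; rewrite cardF => FT.
by have := leq_trans F_large FT; rewrite ltnn.
Qed.

(** The vectors seen from [k] through determining vectors only. *)
Definition star : set 'rV[R]_d :=
  [set w | forall r, 0 <= r -> r <= 1 -> determining ((1 - r) *: iv k + r *: w)].

Lemma star_open w : star w -> \forall w' \near w, star w'.
Proof.
move=> sw.
pose Q w' (r : R) := determining ((1 - r) *: iv k + r *: w').
have nQ : \forall w' \near w, `[0, 1]%classic `<=` Q w'.
  apply: ((compact_near_coveringP _).1 (@segment_compact R 0 1) _ (nbhs w) Q) => r.
  rewrite /= in_itv/= => /andP[r0 r1].
  have cQ : (fun z : R * 'rV[R]_d => (1 - z.1) *: iv k + z.1 *: z.2) @ (r, w) -->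
      (1 - r) *: iv k + r *: w.
    apply: cvgD.
      apply: cvgZ; last exact: cvg_cst.
      by apply: cvgB; [exact: cvg_cst|exact: cvg_fst].
    by apply: cvgZ; [exact: cvg_fst|exact: cvg_snd].
  exact: cQ _ (determining_open (sw r r0 r1)).
apply: filterS nQ => w' Qw' r r0 r1.
by apply: Qw'; rewrite /= in_itv/= r0.
Qed.

Lemma star_closed w : closure star w -> determining w -> star w.
Proof.
move=> cw detw r r0 r1.
have [->|rn0] := eqVneq r 0.
  by rewrite subr0 scale1r scale0r addr0; exact: determining_k.
have [->|rn1] := eqVneq r 1; first by rewrite subrr scale0r scale1r add0r.
apply: determining_limit; [by rewrite lt_neqAle eq_sym rn0|by rewrite lt_neqAle rn1|].
move=> eta eta0; have [w' [sw']] := cw _ (nbhsx_ballx w _ eta0).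
by rewrite -ball_normE /= distrC; exists w'.
Qed.

(** Among the determining vectors, [star] is open and closed, so it contains the
    component of [k]; conversely, its elements are joined to [k] by segments. *)
Lemma component_star (E : set 'rV[R]_d) w :
  (forall u, E u <-> determining u) ->
  connected_component E (iv k) w <-> star w.
Proof.
move=> Edet; split=> [[C [Ck CE coC] Cw]|sw].
  suff CS : C `&` star = C by move: Cw; rewrite -CS => -[].
  apply: coC.
  - exists (iv k); split=> // r _ _; rewrite -scalerDl subrK scale1r.
    exact: determining_k.
  - exists (interior star); first exact: open_interior.
    apply/seteqP; split=> u [Cu su]; split=> //; first exact: star_open.
    exact: interior_subset.
  - exists (closure star); first exact: closed_closure.
    apply/seteqP; split=> u [Cu su]; split=> //; first exact: subset_closure.
    by apply: star_closed => //; apply/Edet; exact: CE.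
pose g (r : R) := (1 - r) *: iv k + r *: w.
exists (g @` `[0, 1]%classic).
  split.
  - by exists 0; rewrite /= ?in_itv/= ?lexx ?ler01// /g subr0 scale1r scale0r addr0.
  - move=> _ [r + <-]; rewrite /= in_itv/= => /andP[r0 r1].
    by apply/Edet; exact: sw.
  - apply: connected_continuous_connected; first exact: segment_connected.
    apply: continuous_subspaceT => r; apply: cvgD; apply: cvgZr_tmp; last exact: cvg_id.
    by apply: cvgB; [exact: cvg_cst|exact: cvg_id].
by exists 1; rewrite /= ?in_itv/= ?lexx ?ler01// /g subrr scale1r scale0r add0r.
Qed.

(** * Expansiveness in terms of labels *)

Lemma action_inv n x : homeo_inv (alpha n) x = alpha (- n) x.
Proof.
apply: (can_inj (homeo_funK (alpha n))).
by rewrite homeo_invK -alphaD addrN action0.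
Qed.

Lemma action_zexpg n (j : int) x : zexpg (alpha n) j x = alpha (j *: n) x.
Proof.
have pos (i : nat) y : (alpha n ^+ i)%g y = alpha (i%:Z *: n) y.
  elim: i y => [|i IHi] y; first by rewrite scale0r action0.
  by rewrite expgS /= IHi -alphaD intS scalerDl scale1r.
case: j => i; first exact: pos.
have /= := pos i.+1 (homeo_inv (alpha n ^+ i.+1)%g x).
rewrite homeo_invK => {2}->.
rewrite -alphaD NegzE scaleNr addNr action0.
by [].
Qed.

(** Closeness is the same as agreement of some finer labels, which are
    themselves determined by a segment of the given labels. *)
Lemma segment_mdist (delta : R) : 0 < delta -> exists N : nat, forall x y,
  (forall j : int, `|j| <= N%:Z -> agree x y (j *: k)) -> mdist x y <= delta.
Proof.
move=> delta0.
have [T [L [lcL Ldelta]]] := clopen_labelling X_compact X_zero_dimensional delta0.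
have [N NP] := line_determines lcL.
by exists N => x y agr; apply/Ldelta/NP.
Qed.

Lemma line_half_plus w z : half_plus <[w]>%VS k z <->
  exists a b : R, 0 <= b /\ z = a *: w + b *: iv k.
Proof.
split=> [[v [b [/vlineP[a ->] b0 ->]]]|[a [b [b0 ->]]]]; first by exists a, b.
by exists (a *: w), b; split=> //; apply/vlineP; exists a.
Qed.

Lemma expansive_determining w :
  expansive_set alpha (half_plus <[w]>%VS k) <-> determining w.
Proof.
split=> [[delta [t [delta0 t0 expF]]]|[t tP]].
  have [N NP] := segment_mdist delta0.
  exists (t + 1 + N%:R * `|iv k|) => x y agr; apply: expF => n.
  move=> /thickening_near[_ /line_half_plus[a [b [b0 ->]]] nab].
  apply: NP => j jN; rewrite agree_shift; apply: (agr _ a b) => //.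
  rewrite intvecD intvecZ -addrA addrC (le_trans (ler_normD _ _))// lerD//.
  by rewrite normrZ ler_wpM2r// norm_intr_le.
have [delta delta0 deltaP] := locally_constant_uniform X_compact P_lc.
exists delta, (Num.sqrt (d%:R * t ^+ 2)); split=> //.
move=> x y near_xy; apply: tP => n a b b0 nab.
apply/deltaP/near_xy/(near_thickening _ nab).
by apply/line_half_plus; exists a, b.
Qed.

Lemma ER_determining w : infinite_set [set: X] -> ER alpha k w <-> determining w.
Proof.
move=> X_infinite; split=> [[w0 [V [dimV expV wV]]]|detw].
  apply/expansive_determining; suff <- : V = <[w]>%VS by [].
  by apply/esym/eqP; rewrite eqEdim -memvE wV dimV dim_vline w0.
have w0 : w != 0.
  apply/eqP => w0; move: detw; rewrite w0.
  exact: (not_determining0).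
split=> //; exists <[w]>%VS; split; [by rewrite dim_vline w0| |exact: memv_line].
exact/expansive_determining.
Qed.

(** Integer points near the half-plane of [m] are within bounded distance of the
    points [i m + j k] with [0 <= j]. *)
Lemma right_expansive_determining m :
  right_expansive (alpha k) (alpha m) <-> determining (iv m).
Proof.
split=> [[delta delta0 expm]|[t tP]].
  have [N NP] := segment_mdist delta0.
  exists (N%:R * `|iv k|) => x y agr; apply: expm => i j j0.
  rewrite !action_zexpg -!alphaD; apply: NP => l lN.
  rewrite agree_shift; apply: (agr _ i%:~R j%:~R); first by rewrite ler0z.
  rewrite !intvecD !intvecZ [X in `|_ + X - _|]addrC addrK normrZ.
  by rewrite ler_wpM2r// norm_intr_le.
pose N := (Num.truncn (t + `|iv m| + `|iv k|)).+1.
have [//|T [L [lcL LP]]] := @window_label (fun n => `|iv n| <= N%:R) N.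
have [delta delta0 deltaP] := locally_constant_uniform X_compact lcL.
exists delta => // x y near_xy; apply: tP => n a b b0 nab.
have : (0 <= Num.floor b) by rewrite floor_ge0.
have := floor_le b; have := floorD1_gt b; have := floor_le a; have := floorD1_gt a.
rewrite !intrD; set i := Num.floor a; set j := Num.floor b => ai ia bj jb j0.
have := near_xy i j j0; rewrite !action_zexpg -!alphaD => /deltaP/LP agr.
rewrite -[n](subrK (j *: k + i *: m)) -agree_shift; apply: agr.
rewrite intvecD intvecN intvecD !intvecZ.
have -> : iv n - (j%:~R *: iv k + i%:~R *: iv m) =
   (iv n - (a *: iv m + b *: iv k)) + (a - i%:~R) *: iv m + (b - j%:~R) *: iv k.
  by apply/rowP => l; rewrite !mxE; ring.
apply: (@le_trans _ _ (t + `|iv m| + `|iv k|)); last by rewrite ltW// truncnS_gt.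
rewrite (le_trans (ler_normD _ _))// lerD//.
  rewrite (le_trans (ler_normD _ _))// lerD// normrZ -[leRHS]mul1r ler_wpM2r//.
  by rewrite ger0_norm; lra.
by rewrite normrZ -[leRHS]mul1r ler_wpM2r// ger0_norm; lra.
Qed.

(** * Resolving systems and determining segments *)

(** In the lattice of the points [i k + j m] the labels agree, and so do the
    vertices, where [c j <= i].  A given point is the upper left corner of a
    rectangle whose bottom and right edges lie in that region, and the squares of
    the rectangle can be filled in row by row, from right to left.  All this
    happens in the parameter plane of [(i, j)], where [k] and [m] may well be
    parallel in space. *)
Lemma pL_determining m (r : R) : essentially_weakly pL (alpha k) (alpha m) ->
  0 < r -> r < 1 -> determining ((1 - r) *: iv k + r *: iv m).
Proof.
move=> /pL_transducer[A' [V [lam [v [lclam lcv lamgen step]]]]] r0 r1.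
have lclamv : locally_constant (fun x => (lam x, v x)).
  by move=> x; apply: filterS2 (lclam x) (lcv x) => y -> ->.
have [N NP] := line_determines lclamv.
pose c := (1 - r) / r; have c0 : 0 < c by rewrite divr_gt0// subr_gt0.
exists (N%:R * `|iv k|) => x y agr.
pose at_ (i j : int) (x : X) := alpha (i *: k + j *: m) x.
have below i j : c * j%:~R <= i%:~R ->
    lam (at_ i j x) = lam (at_ i j y) /\ v (at_ i j x) = v (at_ i j y).
  move=> cij; suff [-> ->] : (lam (at_ i j x), v (at_ i j x)) = (lam (at_ i j y), v (at_ i j y)) by [].
  apply: NP => l lN; rewrite agree_shift.
  apply: (agr _ (j%:~R / r) (i%:~R - c * j%:~R)); first by rewrite subr_ge0.
  have -> : iv (l *: k + (i *: k + j *: m)) - (j%:~R / r *: ((1 - r) *: iv k + r *: iv m) +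
     (i%:~R - c * j%:~R) *: iv k) = l%:~R *: iv k.
    rewrite !intvecD !intvecZ; apply/rowP => i'; rewrite !mxE /c; field.
    by rewrite gt_eqF.
  by rewrite normrZ ler_wpM2r// norm_intr_le.
have left i j (x' : X) : homeo_inv (alpha k) (at_ i j x') = at_ (i - 1) j x'.
  rewrite action_inv /at_ -alphaD.
  by rewrite (_ : (i - 1) *: k + j *: m = - k + (i *: k + j *: m))// scalerBl scale1r addrA [- k + _]addrC.
have up i j (x' : X) : alpha m (at_ i j x') = at_ i (j + 1) x'.
  by rewrite /at_ -alphaD addrCA scalerDl scale1r [m + _]addrC.
apply: lamgen => i; rewrite !action_zexpg.
(* The bottom row is the row [- j0] and the right column is [i + n]. *)
have [j0 j0P] : exists j0 : nat, c * (- j0%:Z)%:~R <= i%:~R.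
  exists (Num.truncn (`|i%:~R| / c)).+1.
  have := truncnS_gt (`|i%:~R : R| / c); rewrite ltr_pdivrMr// intrN mulrN => ij.
  rewrite lerNl mulrC; apply: le_trans (ltW ij).
  by rewrite (le_trans (ler_norm _))// normrN.
have [n nP] : exists n : nat, forall j, j <= 0 -> c * j%:~R <= (i + n%:Z)%:~R.
  exists (absz i) => j j_le0; apply: (@le_trans _ _ 0).
    by rewrite pmulr_rle0// -[0]/(0%:~R) ler_int.
  by rewrite -[0]/(0%:~R) ler_int; lia.
have row (l n' : nat) : (l <= j0)%N -> (n' <= n)%N ->
  lam (at_ (i + n'%:Z) (l%:Z - j0%:Z) x) = lam (at_ (i + n'%:Z) (l%:Z - j0%:Z) y).
  elim: l n' => [|l IHl] n' lj0 n'n.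
    rewrite sub0r; apply: (below _ _ _).1; apply: le_trans j0P _.
    by rewrite ler_int lerDl.
  have side t : (t <= n)%N -> v (at_ (i + (n - t)%N%:Z) (l%:Z - j0%:Z) x) =
                              v (at_ (i + (n - t)%N%:Z) (l%:Z - j0%:Z) y).
    elim: t => [|t IHt] tn.
      by rewrite subn0; apply: (below _ _ _).2; apply: nP; lia.
    have [] := step _ _ (IHl (n - t)%N (ltnW lj0) (leq_subr _ _)) (IHt (ltnW tn)).
    by rewrite !left (_ : i + (n - t)%N%:Z - 1 = i + (n - t.+1)%N%:Z); last lia.
  have side_n' := side _ (leq_subr n' n); rewrite (subKn n'n) in side_n'.
  have [_] := step _ _ (IHl n' (ltnW lj0) n'n) side_n'.
  by rewrite !up (_ : l%:Z - j0%:Z + 1 = l.+1%:Z - j0%:Z)//; lia.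
have := row j0 0%N (leqnn _) (leq0n _).
by rewrite /at_ subrr !addr0 scale0r addr0.
Qed.

(** A disc is meant in the parameters [(a, b)] of [a m + b k].  If [n + m] lies in
    neither of the two discs whose labels are known, then by [tangent_step] the
    first one contains a large piece of a half-plane whose direction lies between
    [k] and [m] and whose frontier passes close to [n + m]. *)
Lemma disc_determines m : star (iv m) -> exists rho : R,
  let W n := exists a b : R, a ^+ 2 + b ^+ 2 <= rho ^+ 2 /\
    `|iv n - (a *: iv m + b *: iv k)| <= 1 in
  forall x y, (forall n, W n -> agree x y n) ->
    (forall n, W n -> agree x y (n + (m + k))) ->
    forall n, W n -> agree x y (n + m).
Proof.
move=> star_m.
have [reach [reach0 reach_le reachP]] := segment_reach.
pose B t := (reach t + 4) * `|iv (k - m)|.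
have [|M MP] := locally_determining_compact B _ star_m.
  move=> r; apply: cvgD; apply: cvgZr_tmp; last exact: cvg_id.
  by apply: cvgB; [exact: cvg_cst|exact: cvg_id].
have M0 : 0 <= M.
  have [||t [t0 tM _]] := MP 0; [lra|lra|exact: le_trans tM].
pose Q := reach M + M + 4; pose rho := 7 * Q ^+ 2 + 2 * Q + 2.
have Q1 : 1 <= Q by rewrite /Q; have := reach0 M; lra.
exists rho => W x y agrW agrWmk n [a [b [ab nab]]].
(* [n + m] has parameters [(a + 1, b)], and [n - k] has [(a, b - 1)]. *)
have [ab1|ab1] := lerP ((a + 1) ^+ 2 + b ^+ 2) (rho ^+ 2).
  apply: agrW; exists (a + 1), b; split=> //.
  rewrite (_ : _ - _ = iv n - (a *: iv m + b *: iv k))//.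
  by rewrite intvecD; apply/rowP => i; rewrite !mxE; ring.
have [ab2|ab2] := lerP (a ^+ 2 + (b - 1) ^+ 2) (rho ^+ 2).
  rewrite (_ : n + m = (n - k) + (m + k)); last by rewrite [m + k]addrC addrA subrK.
  apply: agrWmk; exists a, (b - 1); split=> //.
  rewrite (_ : _ - _ = iv n - (a *: iv m + b *: iv k))//.
  by rewrite intvecD intvecN; apply/rowP => i; rewrite !mxE; ring.
have [r [r0 r1 inside]] := tangent_step Q1 erefl ab ab1 ab2.
have [t [t0 tM tP]] := reachP _ _ _ (MP r r0 r1).
have [jl jr] := floor_add2_bounds (reach t + 1); set j := Num.floor _ + 2 in jl jr.
have reach_t := reach_le _ _ tM; have reach_t0 := reach0 t.
have zn : `|iv (n + m) - ((a + 1) *: iv m + b *: iv k)| <= 1.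
  rewrite (_ : _ - _ = iv n - (a *: iv m + b *: iv k))//.
  by rewrite intvecD; apply/rowP => i; rewrite !mxE; ring.
apply: (tP _ _ _ _ (j *: (k - m)) zn).
  rewrite intvecZ normrZ ler_wpM2r// ger0_norm//; lra.
move=> n' a' b' a'M b'l b'r n'1; apply: agrW.
exists (a + 1 - j%:~R + a' * r), (b + j%:~R + a' * (1 - r) + b'); split.
  by apply: inside; rewrite /Q; lra.
rewrite (_ : _ + _ = (a + 1) *: iv m + b *: iv k + iv (j *: (k - m)) +
   (a' *: ((1 - r) *: iv k + r *: iv m) + b' *: iv k))//.
by rewrite intvecZ intvecD intvecN; apply/rowP => i; rewrite !mxE; ring.
Qed.

(** The arcs are the pairs [(c x, c (psi (tau x)))], with [tau = alpha k] and
    [psi = alpha m].  The second component is the terminal vertex and the first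
    one the image under [p], so [p] is trivially left-resolving; the label
    [c (psi x)], a function of the pair, serves both as initial vertex and as
    image under [q]. *)
Lemma pL_of_label m (T : finType) (c : X -> T) (x0 : X) :
  locally_constant c ->
  (forall x y, (forall j : int, c (alpha (j *: k) x) = c (alpha (j *: k) y)) -> x = y) ->
  (forall x y, c x = c y -> c (alpha (m + k) x) = c (alpha (m + k) y) ->
     c (alpha m x) = c (alpha m y)) ->
  essentially_weakly pL (alpha k) (alpha m).
Proof.
move=> lcc cgen cstep.
pose theta x : fullshift T := fun j => c (alpha (j *: k) x).
have lc_shift n j : locally_constant (fun x => c (alpha (j *: k) (alpha n x))).
  apply: (@locally_constant_precomp X X T (c \o alpha (j *: k)) (alpha n)).
    exact: homeo_fun_continuous.
  exact: (locally_constant_precomp (@homeo_fun_continuous _ (alpha (j *: k))) lcc).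
have ctheta : continuous theta.
  apply: continuous_coordinates => j x; have := lc_shift 0 j x.
  by apply: filterS => y; rewrite !action0.
have theta_inj : injective theta.
  by move=> x y xy; apply: cgen => j; move/(congr1 (fun a : fullshift T => a j)): xy.
have theta_tau x : theta (alpha k x) = shift_map (theta x).
  apply/funext => j; rewrite /theta /shift_map -alphaD.
  by rewrite -{2}[k]scale1r -scalerDl.
pose Y := range theta.
have /choice[theta' theta'P] (a : fullshift T) : exists x, Y a -> theta x = a.
  have [[x _ <-]|nYa] := pselect (Y a); first by exists x.
  by exists x0.
have thetaK : cancel theta theta' by move=> x; apply/theta_inj/theta'P; exists x.
have ctheta' : {within Y, continuous theta'}.
  exact: (compact_inverse_continuous (@fullshift_hausdorff T) X_compact ctheta).
have /choice[Q QP] (ab : T * T) : exists t, forall x, c x = ab.1 ->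
    c (alpha (m + k) x) = ab.2 -> c (alpha m x) = t.
  have [[x [xa xb]]|nab] := pselect (exists x, c x = ab.1 /\ c (alpha (m + k) x) = ab.2).
    by exists (c (alpha m x)) => y ya yb; apply: cstep; rewrite ?xa ?xb.
  by exists ab.1 => x xa xb; exfalso; apply: nab; exists x.
pose Gam := @Graph (T * T)%type T Q snd.
pose G := @Graph T unit (fun=> tt) (fun=> tt).
pose p := @GraphHom (T * T)%type T Gam G fst (fun=> tt) (fun=> erefl) (fun=> erefl).
pose q := @GraphHom (T * T)%type T Gam G Q (fun=> tt) (fun=> erefl) (fun=> erefl).
pose z x : fullshift (T * T)%type := fun j => (theta x j, theta (alpha m x) (j + 1)).
have cz : continuous z.
  apply: continuous_coordinates => j x.
  have H1 := lc_shift 0 j x; have H2 := lc_shift m (j + 1) x.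
  by apply: filterS2 H1 H2 => y; rewrite /z /theta !action0 => -> ->.
have pz x : hom_map p (z x) = theta x by [].
have Qz x j : Q (z x j) = theta (alpha m x) j.
  apply/esym; rewrite {1}/theta -alphaD [_ + m]addrC alphaD; apply: QP => //=.
  by rewrite /theta -!alphaD; congr (c (alpha _ x)); rewrite scalerDl scale1r addrC [m + k]addrC addrA.
have z_tau x : z (alpha k x) = shift_map (z x).
  apply/funext => j; rewrite /z /shift_map theta_tau; congr pair.
  by rewrite -alphaD [m + k]addrC alphaD theta_tau.
have subshift_range (A' : finType) (h : X -> fullshift A') : continuous h ->
    (forall x, h (alpha k x) = shift_map (h x)) -> is_subshift (range h).
  move=> ch hk; split; first exact: (continuous_image_closed (@fullshift_hausdorff A')).
  apply/seteqP; split=> [_ [_ [x _ <-] <-]|_ [x _ <-]].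
    by exists (alpha k x); rewrite ?hk.
  exists (h (homeo_inv (alpha k) x)); first by exists (homeo_inv (alpha k) x).
  by rewrite -hk homeo_invK.
exists T, Y, (theta \o alpha m \o theta'), theta; split.
- exact: subshift_range.
- split.
    split.
    - move=> a; apply: (@continuous_comp (subspace Y) X _ theta' (theta \o alpha m)).
        exact: ctheta'.
      by apply: continuous_comp; [exact: homeo_fun_continuous|exact: ctheta].
    - by move=> a _; exists (alpha m (theta' a)).
    - move=> _ [x _ <-] /=; rewrite -theta_tau !thetaK -theta_tau -!alphaD.
      by rewrite addrC.
  exists G, (T * T)%type, Gam, (Textile p q), (range z); split.
  - by move=> [a1 a2] [b1 b2] /= [-> ->].
  - split; first exact: subshift_range.
    move=> _ [x _ <-] j /=; exact/esym/Qz.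
  - split; last by apply/seteqP; split=> [_ [_ [x _ <-] <-]|_ [x _ <-]]; [exists x|exists (z x); [exists x|]].
    by move=> _ _ /set_mem[x _ <-] /set_mem[y _ <-] /theta_inj ->.
  - by move=> _ [_ [x _ <-] <-]; exists (alpha m x) => //; apply/funext => j; exact/esym/Qz.
  - by move=> _ [x _ <-] /=; rewrite pz thetaK; apply/funext => j; exact/esym/Qz.
- split=> //; last by exists theta'.
  split=> [x _|x y _ _ /theta_inj//|_ [x _ <-]]; [by exists x|by exists x].
- exact: theta_tau.
- by move=> x /=; rewrite thetaK.
Qed.

Lemma star_pL m (x0 : X) : star (iv m) -> essentially_weakly pL (alpha k) (alpha m).
Proof.
move=> /disc_determines[rho]; set W := fun n => _ => discP.
have [|T [c [lcc cP]]] := @window_label W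
    (Num.truncn (1 + (`|rho| * `|iv m| + `|rho| * `|iv k|))).+1.
  move=> n [a [b [ab nab]]].
  have small (r s : R) : r ^+ 2 + s ^+ 2 <= rho ^+ 2 -> `|r| <= `|rho|.
    move=> rs; rewrite -(@ler_pXn2r _ 2)// ?nnegrE// !real_normK ?num_real//.
    by have := sqr_ge0 s; lra.
  apply: (@le_trans _ _ (1 + (`|rho| * `|iv m| + `|rho| * `|iv k|))); last first.
    by rewrite ltW// truncnS_gt.
  rewrite -[iv n](subrK (a *: iv m + b *: iv k)) (le_trans (ler_normD _ _))// lerD//.
  rewrite (le_trans (ler_normD _ _))// !normrZ lerD// ler_wpM2r//.
    exact: small ab.
  by apply: (small b a); rewrite addrC.
apply: (pL_of_label x0 lcc) => [x y xy|x y cxy cmk].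
  apply: P_generates => j; have /cP/(_ 0) := xy j.
  rewrite agree_shift add0r; apply.
  exists 0, 0; split; first by rewrite expr0n /= addr0 sqr_ge0.
  by rewrite !scale0r addr0 subr0 intvec0 normr0.
apply/cP => n Wn; rewrite agree_shift.
apply: discP => // [n' Wn'|n' Wn']; first exact: (cP _ _).1.
by rewrite -agree_shift; exact: (cP _ _).1.
Qed.

End Labels.

(** * The action of the integer lattice and the theorem *)

Section ZdAction.
Variables (R : realType) (X : metricType R) (d : nat).
Variables (psi : 'I_d -> homeo X) (K : set (homeo X)).
Hypothesis K_generated : K = subgroup_generated (range psi).
Hypothesis K_commutative : forall f g, K f -> K g -> commute f g.
Local Open Scope group_scope.

Lemma generated_closed : [/\ K 1, forall f g, K f -> K g -> K (f * g) &
  forall f, K f -> K f^-1].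
Proof.
rewrite K_generated; split.
- by move=> M [[M1 _] _]; exact/set_mem.
- move=> f g Kf Kg M MP; have [Mgroup _] := MP.
  apply: (set_mem (group_closedM Mgroup (x := f) (y := g) _ _)).
    by apply: mem_set; exact: Kf.
  by apply: mem_set; exact: Kg.
- move=> f Kf M MP; have [Mgroup _] := MP.
  by apply: (set_mem (group_closedV Mgroup (mem_set _))); exact: Kf.
Qed.

Lemma generated_zexpg i j : K (zexpg (psi i) j).
Proof.
have [K1 KM KV] := generated_closed.
have Kpsi : K (psi i) by rewrite K_generated; apply: sub_gen_smallest; exists i.
have Kexp n : K (psi i ^+ n).
  by elim: n => [|n IHn]; rewrite ?expg0 ?expgS//; exact: KM.
by case: j => n /=; [exact: Kexp|apply: KV; exact: Kexp].
Qed.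

Lemma zexpgD (g : homeo X) (i j : int) : zexpg g (i + j) = zexpg g i * zexpg g j.
Proof.
have succ (l : int) : zexpg g (l + 1) = g * zexpg g l.
  case: l => [n|[|n]]; first by rewrite -PoszD addn1 /= expgS.
    by rewrite /= expg1 mulgV.
  rewrite (_ : Negz n.+1 + 1 = Negz n)%R; last by rewrite !NegzE; lia.
  by rewrite /= [X in _ * X^-1]expgSr invgM mulVKg.
have pred (l : int) : zexpg g (l - 1) = g^-1 * zexpg g l.
  by rewrite -{2}[l](subrK 1%R) succ mulKg.
elim: i => [|n IHn|n IHn]; first by rewrite add0r /= expg0 mul1g.
  by rewrite intS -addrA addrC succ IHn [(1 + _)%R]addrC succ mulgA.
by rewrite -addn1 PoszD opprD addrAC pred IHn pred mulgA.
Qed.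

Lemma zd_action_mem n : K (zd_action psi n).
Proof.
have [K1 KM _] := generated_closed.
rewrite /zd_action; apply: (big_ind K) => // i _; exact: generated_zexpg.
Qed.

Lemma zd_actionD m n : zd_action psi (m + n)%R = zd_action psi m * zd_action psi n.
Proof.
have [K1 KM _] := generated_closed.
rewrite /zd_action; elim: (index_enum _) => [|i s IHs].
  by rewrite !big_nil mulg1.
rewrite !big_cons IHs mxE zexpgD -!mulgA; congr (_ * _); rewrite !mulgA; congr (_ * _).
apply: K_commutative; first exact: generated_zexpg.
by apply: (big_ind K) => // l _; exact: generated_zexpg.
Qed.

End ZdAction.

Section Main.
Variables (R : realType) (X : metricType R) (d : nat).
Variable alpha : 'rV[int]_d -> homeo X.
Hypothesis X_infinite : infinite_set [set: X].
Hypothesis X_compact : compact [set: X].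
Hypothesis X_zero_dimensional : zero_dimensional X.
Hypothesis alphaD : forall m n x, alpha (m + n) x = alpha m (alpha n x).

(** The segment from [k] to [m] is determining at [k] by expansiveness, at [m] by
    right expansiveness, and in between by the resolving property. *)
Lemma component_pL k m : expansive_vector alpha k ->
  connected_component (ER alpha k) (intvec R k) (intvec R m) <->
  essentially_weakly pL (alpha k) (alpha m) /\ right_expansive (alpha k) (alpha m).
Proof.
move=> [delta delta0 expk].
have [A [P [lcP Pdelta]]] := clopen_labelling X_compact X_zero_dimensional delta0.
have Pgen x y : (forall j : int, agree alpha P x y (j *: k)) -> x = y.
  move=> agr; apply: expk => j; rewrite !(action_zexpg alphaD).
  exact/Pdelta/agr.
have ERP w := ER_determining X_compact X_zero_dimensional alphaD lcP Pgen w X_infinite.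
have rexp := right_expansive_determining X_compact X_zero_dimensional alphaD lcP Pgen m.
rewrite (component_star X_compact alphaD lcP Pgen _ ERP); split=> [star_m|[pLm exp_m] r r0 r1].
  have [x0] : exists x0 : X, True.
    apply: contrapT => noX; apply: X_infinite.
    by rewrite (_ : [set: X] = set0)//; apply/seteqP; split=> // x; case: noX; exists x.
  split; first exact: (star_pL X_compact alphaD lcP Pgen).
  apply/rexp; have := star_m 1 ler01 (lexx _).
  by rewrite subrr scale0r scale1r add0r.
have [->|rn0] := eqVneq r 0.
  rewrite subr0 scale1r scale0r addr0; exact: determining_k.
have [->|rn1] := eqVneq r 1.
  by rewrite subrr scale0r scale1r add0r; apply/rexp.
apply: pL_determining => //; first by rewrite lt_neqAle eq_sym rn0.
by rewrite lt_neqAle rn1.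
Qed.

Lemma half_minusE (V : {vspace 'rV[R]_d}) k : half_minus V k = half_plus V (- k).
Proof.
apply/seteqP; split=> _ [v [b [vV b0 ->]]]; exists v, (- b); split=> //.
- by rewrite oppr_ge0.
- by rewrite intvecN scalerN scaleNr opprK.
- by rewrite oppr_le0.
- by rewrite intvecN scalerN scaleNr.
Qed.

Lemma EL_ER k : EL alpha k = ER alpha (- k).
Proof.
by apply/seteqP; split=> w [w0 [V [dimV expV wV]]]; split=> //; exists V; split=> //;
  move: expV; rewrite /left_expansive_space /right_expansive_space half_minusE.
Qed.

Lemma ER_opp k w : ER alpha k w -> ER alpha k (- w).
Proof.
move=> [w0 [V [dimV expV wV]]]; split; first by rewrite oppr_eq0.
by exists V; rewrite memvN.
Qed.

Lemma component_opp (E : set 'rV[R]_d) v w : (forall u, E u -> E (- u)) ->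
  connected_component E v w -> connected_component E (- v) (- w).
Proof.
move=> EN [C [Cv CE coC] Cw]; exists (-%R @` C); last by exists w.
split; first by exists v.
  by move=> _ [u Cu <-]; exact/EN/CE.
apply: connected_continuous_connected => //.
by apply: continuous_subspaceT => u; exact: opp_continuous.
Qed.

Lemma left_expansive_opp k m : left_expansive (alpha k) (alpha m) <->
  right_expansive (alpha (- k)) (alpha (- m)).
Proof.
have zN n j x : zexpg (alpha (- n)) j x = zexpg (alpha n) (- j) x.
  by rewrite !(action_zexpg alphaD) scalerN scaleNr.
split=> -[delta delta0 expd]; exists delta => // x y near_xy; apply: expd => i j j0.
  have := near_xy (- i) (- j); rewrite oppr_ge0 !zN !opprK; exact.
by have := near_xy (- i) (- j); rewrite oppr_le0 !zN; exact.
Qed.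

Lemma component_qR k m : expansive_vector alpha k ->
  connected_component (EL alpha k) (intvec R k) (intvec R m) <->
  essentially_weakly qR (alpha k) (alpha m) /\ left_expansive (alpha k) (alpha m).
Proof.
move=> expk.
have expNk : expansive_vector alpha (- k).
  have [delta delta0 exp_k] := expk; exists delta => // x y near_xy.
  apply: exp_k => j; have := near_xy (- j).
  by rewrite !(action_zexpg alphaD) !scalerN !scaleNr !opprK.
have alphaN n : homeo_invg (alpha n) = alpha (- n).
  by apply: homeo_eq => x; exact: action_inv.
have alphaC a b x : alpha a (alpha b x) = alpha b (alpha a x).
  by rewrite -!alphaD addrC.
have -> : connected_component (EL alpha k) (intvec R k) (intvec R m) <->
    connected_component (ER alpha (- k)) (intvec R (- k)) (intvec R (- m)).
  rewrite EL_ER !intvecN; split=> [|/component_opp]; first exact/component_opp/ER_opp.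
  by rewrite !opprK; apply; exact: ER_opp.
rewrite component_pL// left_expansive_opp; split=> -[ew exp_m]; split=> //.
  have := essentially_weakly_dual X_compact (alphaC _ _) ew.
  by rewrite !alphaN !opprK.
by have := essentially_weakly_dual X_compact (alphaC _ _) ew; rewrite !alphaN.
Qed.

End Main.
Unset Implicit Arguments.

Theorem theorem11p24 (R : realType) (X : metricType R)
  (X_infinite : infinite_set [set: X])
  (X_zero_dimensional : zero_dimensional X)
  (X_compact : compact [set: X])
  (d : nat) (psi : 'I_d -> homeo X) (K : set (homeo X))
  (K_generated : K = subgroup_generated (range psi))
  (K_commutative : forall f g, K f -> K g -> commute f g)
  (k m : 'rV[int]_d)
  (k_expansive : expansive_vector (zd_action psi) k) :
  let alpha := zd_action psi in
  (connected_component (ER alpha k) (intvec R k) (intvec R m) <->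
     PLo K (alpha k) (alpha m)) /\
  (connected_component (EL alpha k) (intvec R k) (intvec R m) <->
     QRo K (alpha k) (alpha m)).
Proof.
move=> alpha.
have alphaM := zd_actionD K_generated K_commutative.
have alphaD a b x : alpha (a + b) x = alpha a (alpha b x).
  by rewrite /alpha alphaM.
have alphaK n : K (alpha n) by exact: zd_action_mem.
have alpha_aut : automorphism (alpha k) (alpha m) by exact: K_commutative.
rewrite (component_pL X_infinite X_compact X_zero_dimensional alphaD _ k_expansive).
rewrite (component_qR X_infinite X_compact X_zero_dimensional alphaD _ k_expansive).
by split; split=> [[]|[]].
Qed.
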